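(* Let $\mathcal Q$ be as in the context (block off-diagonal with $L^1(\mathbb R)$ entries). Then there exist $n\times n$ matrix functions $K(x,y)$, defined for $y\ge x$, and $J(x,y)$, defined for $y\le x$, such that for all $x,k\in\mathbb R$ \begin{align*} M(x,k)e_+&=e_++\int_x^\infty e^{ik(y-x)}K(x,y)e_+\,dy,& M(x,k)e_-&=e_-+\int_x^\infty e^{-ik(y-x)}K(x,y)e_-\,dy,\\ N(x,k)e_+&=e_++\int_{-\infty}^x e^{-ik(x-y)}J(x,y)e_+\,dy,& N(x,k)e_-&=e_-+\int_{-\infty}^x e^{ik(x-y)}J(x,y)e_-\,dy, \end{align*} and the quantities $$\int_x^\infty\|K(x,y)e_+\|\,dy+\int_{-\infty}^x\|J(x,y)e_+\|\,dy,\qquad \int_x^\infty\|K(x,y)e_-\|\,dy+\int_{-\infty}^x\|J(x,y)e_-\|\,dy$$ are finite and bounded uniformly in $x\in\mathbb R$.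
   Context: Let $m_+,m_-\ge1$ be integers, $n=m_++m_-+1$, and $\Sigma=\mathrm{diag}(I_{m_+},0,-I_{m_-})$, the $n\times n$ diagonal matrix with $m_+$ entries $1$, the entry $0$ in position $m_++1$, and $m_-$ entries $-1$. All $n\times n$ matrices are partitioned into blocks with respect to $n=m_++1+m_-$, with block indices $+,0,-$. The potential is an $n\times n$ matrix function $\mathcal Q(x)=\begin{bmatrix}0_{m_+\times m_+}&q_{+0}(x)&q_{+-}(x)\\ q_{0+}(x)&0&q_{0-}(x)\\ q_{-+}(x)&q_{-0}(x)&0_{m_-\times m_-}\end{bmatrix}$, $x\in\mathbb R$, whose entries belong to $L^1(\mathbb R)$. The AKNS system is $v_x=(ik\Sigma+\mathcal Q(x))v$. Let $e_+=\begin{bmatrix}I_{m_+}\\ 0_{(1+m_-)\times m_+}\end{bmatrix}$, let $e_0$ be the $(m_++1)$-st standard basis column of $\mathbb C^n$, and $e_-=\begin{bmatrix}0_{(m_++1)\times m_-}\\ I_{m_-}\end{bmatrix}$. For $k\in\mathbb R$ the Jost matrices $\Psi(x,k),\Phi(x,k)$ are the unique continuous $n\times n$ solutions of the Volterra equations $\Psi(x,k)=e^{ikx\Sigma}-\int_x^\infty e^{-ik(y-x)\Sigma}\mathcal Q(y)\Psi(y,k)\,dy$ and $\Phi(x,k)=e^{ikx\Sigma}+\int_{-\infty}^x e^{ik(x-y)\Sigma}\mathcal Q(y)\Phi(y,k)\,dy$; they solve the AKNS system with $\Psi(x,k)=e^{ikx\Sigma}[I_n+o(1)]$ as $x\to+\infty$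 and $\Phi(x,k)=e^{ikx\Sigma}[I_n+o(1)]$ as $x\to-\infty$. The Faddeev matrices are $M(x,k)=\Psi(x,k)e^{-ikx\Sigma}$ and $N(x,k)=\Phi(x,k)e^{-ikx\Sigma}$. *)

(* Defs.v *)
From HB Require Import structures.
From mathcomp Require Import all_boot all_order all_algebra.
From mathcomp Require Import all_classical all_reals all_analysis.
From mathcomp Require Import complex.
Set Implicit Arguments. Unset Strict Implicit. Unset Printing Implicit Defensive.
Import Order.TTheory GRing.Theory Num.Theory.
Import numFieldNormedType.Exports.
Local Open Scope ring_scope.
Local Open Scope classical_set_scope.
Local Open Scope complex_scope.

Section AKNS.
Variable R : realType.
Local Notation C := R[i].
Local Notation mu := (@lebesgue_measure R).

Definition cexpi (t : R) : C := (cos t) +i* (sin t).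

Definition cmxnorm (p q : nat) (A : 'M[C]_(p, q)) : R :=
  Num.sqrt (\sum_(i < p) \sum_(j < q) ((complex.Re (A i j)) ^+ 2 + (complex.Im (A i j)) ^+ 2)).

Definition cintegrable (D : set R) (f : R -> C) : Prop :=
  mu.-integrable D (fun y => (complex.Re (f y))%:E) /\
  mu.-integrable D (fun y => (complex.Im (f y))%:E).

Definition cint (D : set R) (f : R -> C) : C :=
  (Rintegral mu D (fun y => complex.Re (f y))) +i* (Rintegral mu D (fun y => complex.Im (f y))).

Definition mxintegrable (p q : nat) (D : set R) (F : R -> 'M[C]_(p, q)) : Prop :=
  forall i j, cintegrable D (fun y => F y i j).

Definition mxint (p q : nat) (D : set R) (F : R -> 'M[C]_(p, q)) : 'M[C]_(p, q) :=
  \matrix_(i, j) cint D (fun y => F y i j).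

Definition ccontinuous (f : R -> C) : Prop :=
  continuous (fun x : R => complex.Re (f x)) /\ continuous (fun x : R => complex.Im (f x)).

Definition mxcontinuous (p q : nat) (F : R -> 'M[C]_(p, q)) : Prop :=
  forall i j, ccontinuous (fun x : R => F x i j).

Variables mp mm : nat.
Local Notation n := (mp + 1 + mm)%N.

Definition sigma (j : 'I_n) : R :=
  if (j < mp)%N then 1 else if (j == mp :> nat) then 0 else -1.

(* block index of j : 0 for '+', 1 for '0', 2 for '-' *)
Definition blk (j : 'I_n) : nat :=
  if (j < mp)%N then 0 else if (j == mp :> nat) then 1 else 2.

Definition Sigma : 'M[C]_n := diag_mx (\row_j (sigma j)%:C).

Definition expiS (t : R) : 'M[C]_n := diag_mx (\row_j cexpi (t * sigma j)).

Definition e_plus : 'M[C]_(n, mp) := col_mx (col_mx 1%:M 0) 0.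
Definition e_minus : 'M[C]_(n, mm) := col_mx 0 1%:M.

Definition admissible_potential (Q : R -> 'M[C]_n) : Prop :=
  (forall x (i j : 'I_n), blk i = blk j -> Q x i j = 0) /\
  mxintegrable setT Q.

(* Psi is the (unique) continuous solution of the Volterra equation
   Psi(x,k) = e^{ikx Sigma} - int_x^oo e^{-ik(y-x)Sigma} Q(y) Psi(y,k) dy *)
Definition is_Jost_Psi (Q : R -> 'M[C]_n) (Psi : R -> R -> 'M[C]_n) : Prop :=
  forall k : R,
    mxcontinuous (fun x : R => Psi x k) /\
    forall x : R,
      let F := fun y => expiS (- (k * (y - x))) *m Q y *m Psi y k in
      mxintegrable [set y | x <= y] F /\
      Psi x k = expiS (k * x) - mxint [set y | x <= y] F.

Definition is_Jost_Phi (Q : R -> 'M[C]_n) (Phi : R -> R -> 'M[C]_n) : Prop :=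
  forall k : R,
    mxcontinuous (fun x : R => Phi x k) /\
    forall x : R,
      let F := fun y => expiS (k * (x - y)) *m Q y *m Phi y k in
      mxintegrable [set y | y <= x] F /\
      Phi x k = expiS (k * x) + mxint [set y | y <= x] F.

Definition Faddeev (Psi : R -> R -> 'M[C]_n) (x k : R) : 'M[C]_n :=
  Psi x k *m expiS (- (k * x)).

End AKNS.

(* Main.v *)
(** For column [j] with [sigma j = s] nonzero, the Volterra equation of the Faddeev matrix reads
    [M_i(x) = delta_ij - \int_x^oo e^{isk a_i (y-x)} \sum_l Q_il(y) M_l(y) dy] with
    [a_i = 1 - s * sigma i >= 0], and [Q_ij = 0] whenever [a_i = 0]. Hence [M_i - delta_ij] is the
    Fourier transform in [t >= 0], at frequency [s k], of a solution [B] of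
    [B_i(x,t) = - Q_ij(x + t/a_i) / a_i - \sum_l \int_x^oo Q_il(y) B_l(y, t - a_i (y-x)) dy].

    Writing each complex number as a nonnegative combination of [1, i, -1, -i] embeds this in a
    four times larger system with nonnegative coefficients, for which Picard iteration from [0]
    increases, so that monotone convergence and Tonelli apply without any convergence estimate. The
    masses [\int B(x,t) dt] of the iterates satisfy [u(x) <= c + \int_x^oo W u] with [W] integrable,
    and Gronwall bounds them uniformly in [x]. Gronwall with [c = 0] gives uniqueness for the Volterra
    equation, which identifies the Fourier transform with the given Jost solution. The kernel [J] comes
    from [K] by the reflection [Phi(-x,-k)], a right Jost solution for [- Q(-x)]. *)

Require Import Defs.
From HB Require Import structures.
From mathcomp Require Import all_boot all_order all_algebra.
From mathcomp Require Import all_classical all_reals all_analysis.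
From mathcomp Require Import measurable_realfun complex ring lra.
Import Order.TTheory GRing.Theory Num.Theory.
Import numFieldNormedType.Exports.
Local Open Scope ring_scope.
Local Open Scope classical_set_scope.
Local Open Scope complex_scope.

(** * Affine changes of variables *)

(** If [a_i = 0] and [Q_ij] did not vanish, the source would be carried by [t = 0] alone and its
    transform would be that of a point mass, not of a function; the block form of the potential
    excludes exactly this. The nonnegative iterates live in the extended reals and their limit may
    be infinite on null sets. For this reason the kernel equation leaves the iteration only in
    integrated form, tested against nonnegative functions [h(t)]. The choice [h = 1] gives the
    recursion for the masses, and [1 + cos(kt)], [1 + sin(kt)], [1] together recover the Fourier
    transform. Testing also moves the translation in [t] from the kernel to [h], where it becomes a
    phase. The splitting into four parts discards all cancellation, which is harmless because
    Gronwall uses only the absolute values of the coefficients. Gronwall in the form used here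
    presupposes some finite bound, of no particular size. It is supplied by induction for the
    iterates, and by integrability of [Q m] for an arbitrary solution of the Volterra equation. *)

Section change_of_variables.
Context {R : realType}.
Notation mu := (@lebesgue_measure R).
Local Open Scope ereal_scope.

(** The image of Lebesgue measure under [x |-> a x + b], multiplied by [a], has the right value on
    half-open intervals, and such a measure is unique. *)
Lemma ge0_integral_affine (a b : R) (f : R -> \bar R) : (0 < a)%R ->
  measurable_fun setT f -> (forall x, 0 <= f x) ->
  a%:E * \int[mu]_x f (a * x + b)%R = \int[mu]_x f x.
Proof.
move=> a0 mf f0.
pose phi : R -> measurableTypeR R := fun x => (a * x + b)%R.
have mphi : measurable_fun setT phi.
  by apply: measurable_funD => //; exact: mulrl_measurable.
have -> : \int[mu]_x f (a * x + b)%R = \int[pushforward mu phi]_x f x.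
  by rewrite ge0_integral_pushforward.
pose k : {nonneg R} := NngNum (ltW a0).
rewrite -[a]/(k%:num) -(@ge0_integral_mscale _ _ _ (pushforward mu phi))//.
apply: eq_measure_integral => A mA _; apply/esym.
apply: (@lebesgue_measure_unique R (mscale k (pushforward mu phi))) => //.
move=> _ [[c d] _ <-] /=.
change (mu `]c, d]%classic = a%:E * mu (phi @^-1` `]c, d]%classic)).
rewrite (_ : phi @^-1` _ = `]((c - b) / a)%R, ((d - b) / a)%R]%classic); last first.
  apply/seteqP; split => x /=; rewrite !in_itv /= /phi.
    by rewrite ltr_pdivrMr// ler_pdivlMr// ltrBlDr lerBrDr [(x * a)%R]mulrC.
  by rewrite ltr_pdivrMr// ler_pdivlMr// ltrBlDr lerBrDr [(x * a)%R]mulrC.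
rewrite !lebesgue_measure_itv /= !lte_fin ltr_pM2r ?invr_gt0// ltrD2r.
case: ifP => _; last by rewrite mule0.
rewrite -!EFinB -EFinM; congr EFin; field; exact: lt0r_neq0.
Qed.

Lemma lebesgue_measure_shift (a : R) (A : set R) : measurable A ->
  pushforward mu ((fun x => x + a)%R : _ -> measurableTypeR R) A = mu A.
Proof.
move=> mA.
pose phi : R -> measurableTypeR R := fun x => (x + a)%R.
have mphi : measurable_fun setT phi by exact: measurable_funD.
apply/esym.
apply: (@lebesgue_measure_unique R (pushforward mu phi)) => //.
move=> _ [[c d] _ <-] /=.
change (mu `]c, d]%classic = mu (phi @^-1` `]c, d]%classic)).
rewrite (_ : phi @^-1` _ = `](c - a)%R, (d - a)%R]%classic); last first.
  by apply/seteqP; split => x /=; rewrite !in_itv /= /phi ltrBlDr lerBrDr.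
rewrite !lebesgue_measure_itv /= !lte_fin ltrD2r; case: ifP => // _.
by rewrite -!EFinB; congr EFin; ring.
Qed.

(** * Maps preserving Lebesgue measure, later translations and the reflection [x |-> -x] *)

Section measure_preserving.
Variable phi : R -> measurableTypeR R.
Hypothesis mphi : measurable_fun setT phi.
Hypothesis phiP : forall A : set R, measurable A -> pushforward mu phi A = mu A.

Lemma integral_preserving (D : set R) (f : R -> \bar R) : measurable D ->
  measurable_fun D f ->
  \int[mu]_(x in phi @^-1` D) f (phi x) = \int[mu]_(x in D) f x.
Proof.
move=> mD mf.
have H (g : R -> \bar R) : measurable_fun D g -> (forall x, 0 <= g x) ->
    \int[mu]_(x in phi @^-1` D) g (phi x) = \int[mu]_(x in D) g x.
  move=> mg g0.
  transitivity (\int[pushforward mu phi]_(x in D) g x).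
    by rewrite ge0_integral_pushforward.
  by apply: eq_measure_integral => A mA _; exact: phiP.
rewrite integralE [RHS]integralE; congr (_ - _).
  rewrite -(H f^\+)//; last exact: measurable_funepos.
  by apply: eq_integral => x _; rewrite !funeposE.
rewrite -(H f^\-)//; last exact: measurable_funeneg.
by apply: eq_integral => x _; rewrite !funenegE.
Qed.

Lemma integrable_preserving (D : set R) (f : R -> \bar R) : measurable D ->
  mu.-integrable D f -> mu.-integrable (phi @^-1` D) (f \o phi).
Proof.
move=> mD /integrableP[mf fi]; apply/integrableP; split.
  apply: (measurable_comp mD) => //; first by move=> _ [x /= Dx <-].
  exact: measurable_funS mphi.
rewrite [ltLHS](@integral_preserving D (fun x => `|f x|))//.
exact: measurableT_comp.
Qed.

End measure_preserving.

End change_of_variables.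

(** * Gronwall inequality *)

Section gronwall.
Context {R : realType}.
Notation mu := (@lebesgue_measure R).
Local Open Scope ereal_scope.

(** Half-lines are kept as comprehensions, the form in which they occur in the definition of the
    Jost solutions. *)
Definition upray (x : R) : set R := [set y | (x <= y)%R].
Definition downray (x : R) : set R := [set y | (y <= x)%R].

Lemma measurable_upray x : measurable (upray x).
Proof.
rewrite (_ : upray x = `[x, +oo[%classic)//.
by apply/seteqP; split => y /=; rewrite /upray /= in_itv /= andbT.
Qed.
#[local] Hint Extern 0 (measurable (upray _)) => solve [exact: measurable_upray] : core.

Lemma measurable_downray x : measurable (downray x).
Proof. by rewrite (_ : downray x = `]-oo, x]%classic). Qed.

Lemma integral_le_sup (D : set R) (W : R -> R) (u : R -> \bar R) (B : R) :
  measurable D -> (forall x, 0 <= W x)%R -> measurable_fun setT W ->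
  measurable_fun setT u -> (forall x, 0 <= u x) ->
  (0 <= B)%R -> (forall x, D x -> u x <= B%:E) ->
  \int[mu]_(y in D) ((W y)%:E * u y) <= B%:E * \int[mu]_(y in D) (W y)%:E.
Proof.
move=> mD W0 mW mu_ u0 B0 uB.
have mW' : measurable_fun D (EFin \o W).
  by apply/measurable_EFinP; exact: measurable_funS mW.
rewrite -ge0_integralZl//; last by move=> x _; rewrite lee_fin.
apply: ge0_le_integral => //.
- by move=> x _; rewrite mule_ge0// lee_fin.
- apply: emeasurable_funM => //; exact: measurable_funS mu_.
- exact: emeasurable_funM.
- by move=> x Dx; rewrite [leRHS]muleC lee_wpmul2l ?lee_fin ?uB.
Qed.

(** * Tails of an integrable weight and the inequality itself *)

Section weight.
Variable W : R -> R.
Hypothesis W0 : forall x, (0 <= W x)%R.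
Hypothesis iW : mu.-integrable setT (EFin \o W).

Let mW : measurable_fun setT W.
Proof. by apply/measurable_EFinP; exact: measurable_int iW. Qed.

Let mWD (D : set R) : measurable_fun D (EFin \o W).
Proof. by apply/measurable_EFinP; exact: measurable_funS mW. Qed.

Let q (x : R) := \int[mu]_(y in upray x) (W y)%:E.

Let q_le x y : (x <= y)%R -> q y <= q x.
Proof.
move=> xy; apply: ge0_subset_integral => //.
- exact: mWD.
- by move=> z _; rewrite lee_fin.
- by move=> z /=; exact: le_trans.
Qed.

(** For [z] in [S] the weight of [[x, z[] is [q x - q z], at most [e]; exhausting [S] from the left
    gives the bound. Only monotonicity of [q] is used, not its continuity. *)
Let level_integral (x r e : R) : (0 <= e)%R -> q x <= (r + e)%:E ->
  let S := [set y | (x <= y)%R /\ r%:E < q y] in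
  measurable S /\ \int[mu]_(y in S) (W y)%:E <= e%:E.
Proof.
move=> e0 qx S.
have mS : measurable S.
  apply: is_interval_measurable => y z [xy qy] [xz qz] t /andP[yt tz].
  split; first exact: le_trans yt.
  by apply: lt_le_trans qz _; exact: q_le.
split => //.
have itv_le z : S z -> \int[mu]_(y in `[x, z[) (W y)%:E <= e%:E.
  move=> [xz rz].
  have : q x = \int[mu]_(y in `[x, z[) (W y)%:E + q z.
    rewrite /q -ge0_integral_setU//=.
    - congr (integral _ _ _); apply/seteqP; split => y /=; rewrite /upray/= in_itv/=.
        move=> ->; case: (ltP y z) => // zy; by [left|right].
      by move=> [/andP[]//|]; exact: le_trans.
    - exact: mWD.
    - by move=> y _; rewrite lee_fin.
    - apply/disj_setPS => y /= []; rewrite in_itv/= /upray /= => /andP[_].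
      by move=> /lt_le_trans /[apply]; rewrite ltxx.
  move=> E; move: qx; rewrite E EFinD => H.
  have : r%:E + \int[mu]_(y in `[x, z[) (W y)%:E <= r%:E + e%:E.
    by apply: le_trans H; rewrite addeC; apply: leeD => //; exact: ltW.
  by rewrite leeD2lE.
(* [F k] is bounded and keeps a margin [1/(k+1)] inside [S], so a point of [S] beyond the supremum
   of [F k] is at hand. *)
pose F (k : nat) := [set y | [/\ (x <= y)%R, (y <= x + k%:R)%R &
  r%:E < q (y + k.+1%:R^-1)]].
have FS k y : F k y -> S (y + k.+1%:R^-1)%R.
  by move=> [xy _ ry]; split => //; rewrite (le_trans xy)// lerDl.
have mF k : measurable (F k).
  apply: is_interval_measurable => y z [xy _ qy] [xz zk qz] t /andP[yt tz].
  split; [exact: le_trans yt|exact: le_trans zk|].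
  by apply: lt_le_trans qz _; apply: q_le; rewrite lerD2r.
have ndF : nondecreasing_seq F.
  move=> k l kl; apply/subsetPset => y [xy yk ry]; split => //.
    by rewrite (le_trans yk)// lerD2l ler_nat.
  apply: lt_le_trans ry _; apply: q_le; rewrite lerD2l lef_pV2 ?posrE//.
  by rewrite ler_nat.
have F_le k : \int[mu]_(y in F k) (W y)%:E <= e%:E.
  have [->|/set0P F0] := eqVneq (F k) set0; first by rewrite integral_set0 lee_fin.
  have hs : has_sup (F k) by split => //; exists (x + k%:R)%R => y [].
  have k0 : (0 < k.+1%:R^-1 :> R)%R by rewrite invr_gt0.
  have [y Fy ys] := sup_adherent k0 hs.
  apply: (@le_trans _ _ (\int[mu]_(z in `[x, (y + k.+1%:R^-1)%R[) (W z)%:E)).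
    apply: ge0_subset_integral => //; first exact: mF.
    - exact: mWD.
    - by move=> z _; rewrite lee_fin.
    - move=> z Fz /=; rewrite in_itv /=; case: (Fz) => -> _ _ /=.
      by rewrite -ltrBlDr (le_lt_trans _ ys)// lerD2r (sup_upper_bound hs).
  exact/itv_le/FS.
have cF : \int[mu]_(y in F k) (W y)%:E @[k --> \oo] -->
    \int[mu]_(y in \bigcup_k F k) (W y)%:E.
  apply: ge0_nondecreasing_set_cvg_integral => //.
  - by move=> k; exact: mWD.
  - by move=> k y _; rewrite lee_fin.
have UF_le : \int[mu]_(y in \bigcup_k F k) (W y)%:E <= e%:E.
  rewrite -(cvg_lim _ cF)//; apply: lime_le; first by apply/cvg_ex; eexists; exact: cF.
  by near=> k; exact: F_le.
have mUF : measurable (\bigcup_k F k) by exact: bigcupT_measurable.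
have SF : S = (S `&` \bigcup_k F k) `|` (S `\` \bigcup_k F k) by rewrite setUIDK.
rewrite SF ge0_integral_setU//; last 5 first.
- exact: measurableI.
- exact: measurableD.
- exact: mWD.
- by move=> y _; rewrite lee_fin.
- by apply/disj_setPS => y [[_ Fy] [_ nFy]].
rewrite [X in _ + X](_ : _ = 0) ?adde0.
  apply: le_trans UF_le; apply: ge0_subset_integral => //.
  - exact: measurableI.
  - exact: mWD.
  - by move=> y _; rewrite lee_fin.
(* A point of [S] missed by every [F k] has no point of [S] to its right; there is at most one such
   point, and it is null. *)
have maxS y z : (S `\` \bigcup_k F k) y -> S z -> (z <= y)%R.
  move=> [[xy qy] nF] [xz qz]; rewrite leNgt; apply/negP => yz; apply: nF.
  have [k ky] : exists k : nat, (k.+1%:R^-1 < z - y /\ y - x <= k%:R)%R.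
    pose a := (Num.max (z - y)^-1 (y - x))%R.
    exists (Num.truncn a).+1; split.
      rewrite invf_plt ?posrE ?subr_gt0//.
      apply: (le_lt_trans (y := a)); first by rewrite /a le_max lexx.
      by rewrite (lt_trans (truncnS_gt _))// ltr_nat.
    by apply: le_trans (ltW (truncnS_gt a)); rewrite /a le_max lexx orbT.
  exists k => //; split => //; first by rewrite -lerBlDl; case: ky.
  by apply: lt_le_trans qz _; apply: q_le; rewrite -lerBrDl ltW//; case: ky.
have [->|/set0P[y Sy]] := eqVneq (S `\` \bigcup_k F k) set0.
  by rewrite integral_set0.
apply: (integral_Sset1 y) => z Sz /=; apply/eqP; rewrite eq_le.
by rewrite (maxS y z)//; [rewrite (maxS z y)//; case: Sy|case: Sz].
Unshelve. all: by end_near. Qed.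

(* Induction on [n] over the level sets [q x <= n / 2]: passing from one level to the next costs
   an integral of mass at most [1 / 2], which the supremum of [u] absorbs. *)
Lemma gronwall : exists C : R, (0 <= C)%R /\
  forall (x0 c : R) (u : R -> \bar R), (0 <= c)%R ->
    measurable_fun setT u -> (forall x, 0 <= u x) ->
    (exists L : R, forall x, (x0 <= x)%R -> u x <= L%:E) ->
    (forall x, (x0 <= x)%R ->
       u x <= c%:E + \int[mu]_(y in upray x) ((W y)%:E * u y)) ->
    forall x, (x0 <= x)%R -> u x <= (C * c)%:E.
Proof.
pose Q := fine (\int[mu]_y (W y)%:E).
have Q0 : (0 <= Q)%R by apply/fine_ge0/integral_ge0 => y _; rewrite lee_fin.
have QE : \int[mu]_y (W y)%:E = Q%:E by rewrite fineK//; exact: integrable_fin_num iW.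
have leQ (D : set R) : measurable D -> \int[mu]_(y in D) (W y)%:E <= Q%:E.
  move=> mD; rewrite -QE; apply: ge0_subset_integral => //.
  - exact: mWD.
  - by move=> z _; rewrite lee_fin.
(* The recursion solves [s <= (1 + Q K_n) c + s / 2] for the supremum [s] on the next level. *)
pose K n := iter n (fun k => 2 * (1 + Q * k))%R 1%R.
have K0 n : (0 <= K n)%R.
  by elim: n => [|n IH] //=; rewrite mulr_ge0// addr_ge0// mulr_ge0.
(* This many levels of height [1/2] cover all values of [q], which are at most [Q]. The constant
   depends on [W] only, hence not on [x0]. *)
exists (K (Num.truncn (2 * Q)).+1); split => //.
move=> x0 c u c0 mu_ u0 [L uL] uI x x0x.
have L0 : (0 <= L)%R by rewrite -lee_fin (le_trans (u0 x))// uL.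
suff H n : forall x, (x0 <= x)%R -> q x <= (n%:R / 2)%:E -> u x <= (K n * c)%:E.
  apply: H => //; apply: le_trans (leQ _ (measurable_upray x)) _.
  by rewrite lee_fin ler_pdivlMr// mulrC ltW// truncnS_gt.
(* On the lowest level the weight to the right of [x] has mass zero, so the integral of the bounded
   [u] against it vanishes. *)
elim: n => [|n IH] {x x0x} x x0x qx.
  apply: le_trans (uI _ x0x) _; rewrite /= mul1r -[leRHS]adde0; apply: leeD2l.
  apply: (le_trans (@integral_le_sup _ W u L _ _ _ _ _ _ _)) => //.
  - by move=> y /= xy; apply: uL; exact: le_trans xy.
  - by rewrite -(mule0 L%:E) lee_wpmul2l ?lee_fin//; rewrite mul0r in qx.
pose E := [set y : R | (x0 <= y)%R /\ q y <= (n.+1%:R / 2)%:E].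
pose V := [set fine (u y) | y in E].
have ufin y : E y -> u y = (fine (u y))%:E.
  move=> [x0y _]; rewrite fineK// ge0_fin_numE//.
  by apply: le_lt_trans (uL _ x0y) _; rewrite ltry.
have hsV : has_sup V.
  split; first by exists (fine (u x)), x.
  exists L => _ [y Ey <-]; rewrite -lee_fin -ufin//; apply: uL; by case: Ey.
pose s := sup V.
have us y : E y -> u y <= s%:E.
  by move=> Ey; rewrite ufin// lee_fin; apply: sup_upper_bound => //; exists y.
have s0 : (0 <= s)%R.
  by rewrite -lee_fin (le_trans (u0 x))// us.
have step y : E y -> u y <= ((1 + Q * K n) * c + s / 2)%:E.
  move=> Ey; have [x0y qy] := Ey.
  have := @level_integral y (n%:R / 2) (1 / 2).
  rewrite -mulrDl natr1 => /(_ _ qy)[]; first by rewrite divr_ge0.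
  set S := [set _ | _] => mS S_le.
  apply: le_trans (uI _ x0y) _.
  have mWu (D : set R) : measurable_fun D (fun z => (W z)%:E * u z).
    by apply: emeasurable_funM; [exact: mWD|exact: measurable_funS mu_].
  have -> : upray y = S `|` (upray y `\` S).
    by rewrite setDUK// => z [].
  rewrite ge0_integral_setU//; last 4 first.
  - exact: measurableD.
  - exact: mWu.
  - by move=> z _; rewrite mule_ge0// lee_fin.
  - by apply/disj_setPS => z [Sz []].
  have H1 : \int[mu]_(z in S) ((W z)%:E * u z) <= (s / 2)%:E.
    apply: (le_trans (@integral_le_sup _ W u s _ _ _ _ _ _ _)) => //.
      move=> z [yz _]; apply: us; split; first exact: le_trans yz.
      by apply: le_trans qy; exact: q_le.
    by rewrite EFinM lee_wpmul2l ?lee_fin// -div1r.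
  have H2 : \int[mu]_(z in upray y `\` S) ((W z)%:E * u z) <= (Q * K n * c)%:E.
    have mD : measurable (upray y `\` S) by exact: measurableD.
    apply: (le_trans (@integral_le_sup _ W u (K n * c)%R _ _ _ _ _ _ _)) => //.
    - by rewrite mulr_ge0.
    - move=> z [yz nS]; apply: IH; first exact: le_trans yz.
      by rewrite leNgt; apply/negP => H; apply: nS.
    - rewrite (_ : Q * K n * c = K n * c * Q)%R; last by ring.
      by rewrite [leRHS]EFinM lee_wpmul2l ?lee_fin ?mulr_ge0//; exact: leQ.
  apply: le_trans (leeD2l _ (leeD H1 H2)) _.
  by rewrite -!EFinD lee_fin; lra.
have : (s <= (1 + Q * K n) * c + s / 2)%R.
  apply: sup_le_ub; first by case: hsV.
  by move=> _ [y Ey <-]; rewrite -lee_fin -ufin// step.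
have Ex : E x by [].
move=> sle; apply: le_trans (us _ Ex) _; rewrite lee_fin /=.
by rewrite -/(K n); lra.
Qed.

End weight.
End gronwall.

(** * Volterra integrals on half-lines *)

Section heaviside.
Context {R : realType}.
Notation mu := (@lebesgue_measure R).
Local Open Scope ereal_scope.

(** As a factor of the integrand it makes a half-line with variable endpoint jointly measurable, as
    Tonelli requires. *)
Definition heaviside (x y : R) : R := (x <= y)%R%:R.

Lemma heaviside_ge0 x y : (0 <= heaviside x y)%R. Proof. exact: ler0n. Qed.

Lemma integral_upray x (f : R -> \bar R) :
  \int[mu]_(y in upray x) f y = \int[mu]_y ((heaviside x y)%:E * f y).
Proof.
rewrite integral_mkcond; apply: eq_integral => y _.
rewrite patchE /heaviside; case: ifPn => [|/negP yx].
  by rewrite inE /upray /= => ->; rewrite mul1e.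
case: (lerP x y) => [xy|]; last by rewrite mul0e.
by exfalso; apply: yx; rewrite inE.
Qed.

Lemma measurable_heaviside d (S : measurableType d) (f g : S -> R) :
  measurable_fun setT f -> measurable_fun setT g ->
  measurable_fun setT (fun s => heaviside (f s) (g s)).
Proof.
move=> mf mg.
rewrite (_ : (fun _ => _) = (fun s => if (f s <= g s)%R then 1%R else 0%R)).
  by apply: measurable_fun_ifT => //; exact: measurable_fun_ler.
by apply/funext => s; rewrite /heaviside; case: (_ <= _)%R.
Qed.

Lemma measurable_section1 (A : R * R -> \bar R) (x : R) :
  measurable_fun setT A -> measurable_fun setT (fun t : R => A (x, t)).
Proof. by move=> mA; apply: measurableT_comp => //; exact: measurable_fun_pair. Qed.

Lemma measurable_integral2 (A : R * R -> \bar R) :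
  measurable_fun setT A -> (forall z, 0 <= A z) ->
  measurable_fun setT (fun x : R => \int[mu]_t A (x, t)).
Proof. exact: (@measurable_fun_fubini_tonelli_F _ _ _ _ _ mu A). Qed.

(* Tonelli, then the translation [t |-> t + b (y - x)] in the inner integral. *)
Lemma integral_transport (x b : R) (h w : R -> R) (A : R * R -> \bar R) :
  measurable_fun setT h -> (forall t, 0 <= h t)%R ->
  measurable_fun setT w -> (forall t, 0 <= w t)%R ->
  measurable_fun setT A -> (forall z, 0 <= A z) ->
  \int[mu]_t ((h t)%:E * \int[mu]_(y in upray x) ((w y)%:E * A (y, t - b * (y - x))%R)) =
  \int[mu]_(y in upray x) ((w y)%:E * \int[mu]_t ((h (t + b * (y - x))%R)%:E * A (y, t))).
Proof.
move=> mh h0 mw w0 mA A0.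
pose F (z : R * R) := ((h z.1)%:E *
  ((heaviside x z.2)%:E * ((w z.2)%:E * A (z.2, z.1 - b * (z.2 - x))%R)))%E.
have F0 z : 0 <= F z.
  by rewrite /F !mule_ge0 ?lee_fin ?heaviside_ge0.
have msh : measurable_fun setT (fun z : R * R => (z.2, z.1 - b * (z.2 - x))%R).
  apply: measurable_fun_pair => //; apply: measurable_funB => //.
  by apply: measurable_funM => //; apply: measurable_funB.
have mF : measurable_fun setT F.
  apply: emeasurable_funM; first by apply/measurable_EFinP; exact: measurableT_comp.
  apply: emeasurable_funM; first by apply/measurable_EFinP; exact: measurable_heaviside.
  apply: emeasurable_funM; first by apply/measurable_EFinP; exact: measurableT_comp.
  exact: measurableT_comp.
have mFs t : measurable_fun setT (fun y : R =>
    (heaviside x y)%:E * ((w y)%:E * A (y, t - b * (y - x))%R)).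
  apply: emeasurable_funM; first by apply/measurable_EFinP; exact: measurable_heaviside.
  apply: emeasurable_funM; first by apply/measurable_EFinP; exact: measurableT_comp.
  apply: measurableT_comp => //; apply: measurable_fun_pair => //.
  apply: measurable_funB => //.
  by apply: measurable_funM => //; apply: measurable_funB.
transitivity (\int[mu]_t \int[mu]_y F (t, y)).
  apply: eq_integral => t _; rewrite integral_upray -ge0_integralZl ?lee_fin//.
    exact: mFs.
  by move=> y _; rewrite !mule_ge0 ?lee_fin ?heaviside_ge0.
transitivity (\int[mu]_y \int[mu]_t F (t, y)); first exact: fubini_tonelli.
rewrite integral_upray; apply: eq_integral => y _.
set c := (b * (y - x))%R.
have mhA : measurable_fun setT (fun t : R => (h t)%:E * A (y, (t - c)%R)).
  apply: emeasurable_funM; first exact/measurable_EFinP.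
  apply: measurableT_comp => //; apply: measurable_fun_pair => //.
  exact: measurable_funB.
have hA0 t : 0 <= (h t)%:E * A (y, (t - c)%R) by rewrite mule_ge0 ?lee_fin.
transitivity ((heaviside x y)%:E * ((w y)%:E * \int[mu]_t ((h t)%:E * A (y, (t - c)%R)))).
  rewrite muleA -EFinM -ge0_integralZl ?lee_fin ?mulr_ge0 ?heaviside_ge0//.
  apply: eq_integral => t _.
  rewrite /F /= EFinM -[RHS]muleA [LHS]muleCA; congr (_ * _).
  by rewrite [LHS]muleCA.
congr (_ * (_ * _)).
rewrite -(@ge0_integral_affine _ 1 c)// mul1e; apply: eq_integral => t _.
by rewrite mul1r addrK.
Qed.

Lemma measurable_integral_upray d (S : measurableType d) (f : S -> R)
    (F : S * R -> \bar R) :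
  measurable_fun setT f -> measurable_fun setT F -> (forall z, 0 <= F z) ->
  measurable_fun setT (fun s => \int[mu]_(y in upray (f s)) F (s, y)).
Proof.
move=> mf mF F0.
under eq_fun do rewrite integral_upray.
apply: (@measurable_fun_fubini_tonelli_F _ _ _ _ _ mu
  (fun z : S * R => (heaviside (f z.1) z.2)%:E * F (z.1, z.2))).
  apply: emeasurable_funM.
    by apply/measurable_EFinP; apply: measurable_heaviside => //; exact: measurableT_comp.
  by under eq_fun do rewrite -surjective_pairing.
by move=> z; rewrite mule_ge0 ?lee_fin ?heaviside_ge0.
Qed.

End heaviside.

(** * Systems with nonnegative coefficients *)

Section nonneg_system.
Context {R : realType} {T : finType}.
Notation mu := (@lebesgue_measure R).
Local Open Scope ereal_scope.
Variables (w : T -> T -> R -> R) (a : T -> R) (p : T -> R -> R).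
Hypothesis w0 : forall i j x, (0 <= w i j x)%R.
Hypothesis iw : forall i j, mu.-integrable setT (EFin \o w i j).
Hypothesis a0 : forall i, (0 <= a i)%R.
Hypothesis p0 : forall i x, (0 <= p i x)%R.
Hypothesis ip : forall i, mu.-integrable setT (EFin \o p i).
Hypothesis pa0 : forall i x, a i = 0%R -> p i x = 0%R.

Let mw i j : measurable_fun setT (w i j).
Proof. by apply/measurable_EFinP; exact: measurable_int (iw i j). Qed.

Let mp i : measurable_fun setT (p i).
Proof. by apply/measurable_EFinP; exact: measurable_int (ip i). Qed.

(** Density in [t] of the image of [p i y dy] on [y >= x] under [y |-> a i (y - x)]. For [a i = 0]
    division by zero returns [0], which is the correct value since then [p i = 0]. *)
Let g i (z : R * R) : R :=
  (if 0 <= z.2 then p i (z.1 + z.2 / a i) / a i else 0)%R.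

Let g0 i z : (0 <= g i z)%R.
Proof. by rewrite /g; case: ifP => // _; rewrite divr_ge0. Qed.

Let mg i : measurable_fun setT (g i).
Proof.
apply: measurable_fun_ifT => //; first exact: measurable_fun_ler.
apply: measurable_funM => //; apply: measurableT_comp => //.
by apply: measurable_funD => //; exact: measurable_funM.
Qed.

Let integral_g i x (h : R -> R) : measurable_fun setT h -> (forall t, 0 <= h t)%R ->
  \int[mu]_t (h t * g i (x, t))%:E =
  \int[mu]_(y in upray x) (p i y * h (a i * (y - x)))%:E.
Proof.
move=> mh h0; have [ai0|ai0] := eqVneq (a i) 0%R.
  rewrite integral0_eq; last first.
    by move=> t _; rewrite /g /= pa0// mul0r; case: ifP; rewrite mulr0.
  by rewrite integral0_eq// => t _; rewrite pa0// mul0r.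
have ai : (0 < a i)%R by rewrite lt0r ai0/=.
have maff : measurable_fun setT (fun y : R => a i * y - a i * x)%R.
  by apply: measurable_funB => //; exact: mulrl_measurable.
have mhg : measurable_fun setT (fun y : R =>
    (h (a i * y - a i * x) * g i (x, (a i * y - a i * x)))%:E).
  apply/measurable_EFinP; apply: measurable_funM => //; first exact: measurableT_comp.
  by apply: (measurableT_comp (mg i)); exact: measurable_fun_pair.
rewrite -(@ge0_integral_affine _ (a i) (- (a i * x))%R)//; last 2 first.
- apply/measurable_EFinP; apply: measurable_funM => //.
  by apply: (measurableT_comp (mg i)); exact: measurable_fun_pair.
- by move=> t; rewrite lee_fin mulr_ge0.
rewrite integral_upray -ge0_integralZl//; last 2 first.
- by move=> t _; rewrite lee_fin mulr_ge0.
- by rewrite lee_fin ltW.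
apply: eq_integral => y _; rewrite -!EFinM /g /= -mulrBr /heaviside.
rewrite pmulr_rge0// subr_ge0; case: ifP => xy; congr EFin.
  rewrite mul1r (_ : x + a i * (y - x) / a i = y)%R; last by field.
  by field.
by rewrite !mulr0 mul0r.
Qed.

Let picard (A : T -> R * R -> \bar R) i (z : R * R) : \bar R :=
  (g i z)%:E + \sum_j \int[mu]_(y in upray z.1) ((w i j y)%:E * A j (y, z.2 - a i * (y - z.1))%R).

(** * The Picard map on nonnegative measurable families *)

Section picard.
Variable A : T -> R * R -> \bar R.
Hypothesis mA : forall i, measurable_fun setT (A i).
Hypothesis A0 : forall i z, 0 <= A i z.

Let term0 i j x t y : 0 <= (w i j y)%:E * A j (y, t - a i * (y - x))%R.
Proof. by rewrite mule_ge0 ?lee_fin. Qed.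

Let int0 i j x t :
  0 <= \int[mu]_(y in upray x) ((w i j y)%:E * A j (y, t - a i * (y - x))%R).
Proof. by apply: integral_ge0. Qed.

Lemma picard_ge0 i z : 0 <= picard A i z.
Proof. by rewrite adde_ge0 ?lee_fin// sume_ge0. Qed.

Let mint i j : measurable_fun setT (fun z : R * R =>
  \int[mu]_(y in upray z.1) ((w i j y)%:E * A j (y, z.2 - a i * (y - z.1))%R)).
Proof.
apply: (@measurable_integral_upray _ _ _ fst (fun s : (R * R) * R =>
  ((w i j s.2)%:E * A j (s.2, s.1.2 - a i * (s.2 - s.1.1))%R))) => //.
have m11 : measurable_fun setT (fun s : (R * R) * R => s.1.1) by exact: measurableT_comp.
have m12 : measurable_fun setT (fun s : (R * R) * R => s.1.2) by exact: measurableT_comp.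
apply: emeasurable_funM; first by apply/measurable_EFinP; exact: measurableT_comp.
apply: measurableT_comp => //; apply: measurable_fun_pair => //.
by apply: measurable_funB => //; apply: measurable_funM => //; exact: measurable_funB.
Qed.

Lemma measurable_picard i : measurable_fun setT (picard A i).
Proof.
apply: emeasurable_funD; first exact/measurable_EFinP.
by apply: emeasurable_sum => j; exact: mint.
Qed.

(** The weak form of one Picard step: the source is pushed forward by [integral_g], and the coupling
    is handled by [integral_transport], which transfers the translation to [h]. *)
Lemma integral_picard i x (h : R -> R) : measurable_fun setT h -> (forall t, 0 <= h t)%R ->
  \int[mu]_t ((h t)%:E * picard A i (x, t)) =
  \int[mu]_(y in upray x) (p i y * h (a i * (y - x)))%:E +
  \sum_j \int[mu]_(y in upray x) ((w i j y)%:E *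
     \int[mu]_t ((h (t + a i * (y - x))%R)%:E * A j (y, t))).
Proof.
move=> mh h0.
have mhint j : measurable_fun setT (fun t : R => (h t)%:E *
    \int[mu]_(y in upray x) ((w i j y)%:E * A j (y, t - a i * (y - x))%R)).
  apply: emeasurable_funM; first exact/measurable_EFinP.
  exact: (@measurable_section1 _ (fun z => \int[mu]_(y in upray z.1)
    ((w i j y)%:E * A j (y, z.2 - a i * (y - z.1))%R))).
under eq_integral => t _.
  rewrite /picard ge0_muleDr ?lee_fin ?sume_ge0//= -EFinM.
  rewrite ge0_sume_distrr//; over.
rewrite /= ge0_integralD//; last 4 first.
- by move=> t _; rewrite lee_fin mulr_ge0.
- apply/measurable_EFinP; apply: measurable_funM => //.
  by apply: (measurableT_comp (mg i)); exact: measurable_fun_pair.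
- by move=> t _; apply: sume_ge0 => j _; rewrite mule_ge0 ?lee_fin.
- by apply: emeasurable_sum => j; exact: mhint.
apply: f_equal2; first exact: integral_g.
transitivity (\sum_j \int[mu]_t ((h t)%:E *
    \int[mu]_(y in upray x) ((w i j y)%:E * A j (y, t - a i * (y - x))%R))).
  by apply: ge0_integral_sum => // j t _; rewrite mule_ge0 ?lee_fin.
by apply: eq_bigr => j _; exact: integral_transport.
Qed.

End picard.

Let measurable_term (A : T -> R * R -> \bar R) i j x t (D : set R) :
  measurable_fun setT (A j) ->
  measurable_fun D (fun y : R => (w i j y)%:E * A j (y, t - a i * (y - x))%R).
Proof.
move=> mA; apply: (@measurable_funS _ _ _ _ setT) => //.
apply: emeasurable_funM; first exact/measurable_EFinP.
apply: (measurableT_comp mA); apply: measurable_fun_pair => //.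
apply: measurable_funB => //; apply: measurable_funM => //.
exact: measurable_funB.
Qed.

Let le_picard (A B : T -> R * R -> \bar R) i z :
  (forall i, measurable_fun setT (A i)) -> (forall i, measurable_fun setT (B i)) ->
  (forall i z, 0 <= A i z) -> (forall i z, A i z <= B i z) ->
  picard A i z <= picard B i z.
Proof.
move=> mA mB A0 AB; apply: leeD2l; apply: lee_sum => j _.
apply: ge0_le_integral.
- exact: measurable_upray.
- by move=> y _; rewrite mule_ge0 ?lee_fin.
- exact: measurable_term.
- exact: measurable_term.
- by move=> y _; rewrite lee_wpmul2l ?lee_fin.
Qed.

(** * The iterates and a uniform bound for their masses *)

Let At m := iter m picard (fun _ _ => 0).

Let At_ge0 m i z : 0 <= At m i z.
Proof. by elim: m i z => // m IH i z; exact: picard_ge0. Qed.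

Let mAt m i : measurable_fun setT (At m i).
Proof.
elim: m i => [|m IH] i; first exact: measurable_cst.
exact: (measurable_picard _ IH (At_ge0 m)).
Qed.

Let At_le m i z : At m i z <= At m.+1 i z.
Proof.
elim: m i z => [|m IH] i z; first exact: (At_ge0 1).
exact: (le_picard _ _ _ _ (mAt m) (mAt m.+1) (At_ge0 m) IH).
Qed.

Let At_nd i z : nondecreasing_seq (fun m => At m i z).
Proof. by apply/nondecreasing_seqP => m; exact: At_le. Qed.

(** Since [a i >= 0] and [y >= x], the coupling evaluates the previous iterate at times no later
    than [t]. *)
Let At_supp m i x t : (t < 0)%R -> At m i (x, t) = 0.
Proof.
elim: m i x t => // m IH i x t t0.
rewrite /At iterS /picard /= /g /= leNgt t0 /= add0e big1// => j _.
rewrite integral0_eq// => y /= xy; rewrite -/(At m) IH ?mule0//.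
by rewrite (le_lt_trans _ t0)// lerBlDr lerDl mulr_ge0// subr_ge0.
Qed.

Let v m j (y : R) := \int[mu]_t At m j (y, t).

Let v_ge0 m j y : 0 <= v m j y.
Proof. by apply: integral_ge0 => t _; exact: At_ge0. Qed.

Let mv m j : measurable_fun setT (v m j).
Proof. exact: (measurable_integral2 _ (mAt m j) (At_ge0 m j)). Qed.

Let vS m i x : v m.+1 i x = \int[mu]_(y in upray x) (p i y)%:E +
  \sum_j \int[mu]_(y in upray x) ((w i j y)%:E * v m j y).
Proof.
have := @integral_picard (At m) (mAt m) (At_ge0 m) i x (fun=> 1%R).
move=> /(_ (measurable_cst _) (fun=> ler01)) H.
transitivity (\int[mu]_t (1%:E * picard (At m) i (x, t))).
  by apply: eq_integral => t _; rewrite mul1e.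
rewrite H; apply: f_equal2.
  by apply: eq_integral => y _; rewrite mulr1.
apply: eq_bigr => j _; apply: eq_integral => y _; congr (_ * _).
by apply: eq_integral => t _; rewrite mul1e.
Qed.

(** One scalar weight dominating all couplings reduces the vector of masses to the scalar Gronwall
    inequality for their sum. *)
Let W (y : R) : R := (\sum_i \sum_j w i j y)%R.

Let W0 y : (0 <= W y)%R.
Proof. by apply: sumr_ge0 => i _; apply: sumr_ge0. Qed.

Let iW : mu.-integrable setT (EFin \o W).
Proof.
rewrite (_ : EFin \o W = fun y => \sum_i \sum_j (w i j y)%:E).
  by apply: integrable_sum => // i _; apply: integrable_sum => // j _; exact: iw.
by apply/funext => y; rewrite /= /W -sumEFin; apply: eq_bigr => i _; rewrite sumEFin.
Qed.

Let u m (x : R) := \sum_i v m i x.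

Let mu_ m : measurable_fun setT (u m).
Proof. by apply: emeasurable_sum => i; exact: mv. Qed.

Let u_ge0 m x : 0 <= u m x.
Proof. by apply: sume_ge0. Qed.

Let c := fine (\sum_i \int[mu]_y (p i y)%:E).

Let cE : \sum_i \int[mu]_y (p i y)%:E = c%:E.
Proof.
rewrite /c fineK//; apply/sum_fin_numP => i _ _; exact: integrable_fin_num (ip i).
Qed.

Let c0 : (0 <= c)%R.
Proof. by apply/fine_ge0/sume_ge0 => i _; apply: integral_ge0 => y _; rewrite lee_fin. Qed.

Let mwv m i j (D : set R) : measurable_fun D (fun y => (w i j y)%:E * v m j y).
Proof.
apply: (@measurable_funS _ _ _ _ setT) => //.
by apply: emeasurable_funM; [exact/measurable_EFinP|exact: mv].
Qed.

Let u_le m x : u m.+1 x <= c%:E + \int[mu]_(y in upray x) ((W y)%:E * u m y).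
Proof.
rewrite /u; under eq_bigr do rewrite vS.
rewrite big_split /=; apply: leeD.
  rewrite -cE; apply: lee_sum => i _; apply: ge0_subset_integral => //.
  - exact: measurable_upray.
  - exact: measurable_int (ip i).
  - by move=> y _; rewrite lee_fin.
have mS i (D : set R) : measurable_fun D (fun y => \sum_j ((w i j y)%:E * v m j y)).
  by apply: emeasurable_sum => j; exact: mwv.
rewrite (_ : \sum_i _ = \int[mu]_(y in upray x) \sum_i \sum_j ((w i j y)%:E * v m j y)).
  apply: ge0_le_integral.
  - exact: measurable_upray.
  - by move=> y _; apply: sume_ge0 => i _; apply: sume_ge0 => j _; rewrite mule_ge0 ?lee_fin.
  - by apply: emeasurable_sum => i; exact: mS.
  - apply: (@measurable_funS _ _ _ _ setT) => //; apply: emeasurable_funM; last exact: mu_.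
    exact: measurable_int iW.
  - move=> y _; rewrite /W -sumEFin ge0_sume_distrl; last first.
      by move=> i _; rewrite lee_fin sumr_ge0.
    apply: lee_sum => i _; rewrite -sumEFin ge0_sume_distrl//; last first.
      by move=> j _; rewrite lee_fin.
    apply: lee_sum => j _; rewrite lee_wpmul2l ?lee_fin//.
    by rewrite (bigD1 j)//= leeDl// sume_ge0.
transitivity (\sum_i \int[mu]_(y in upray x) \sum_j ((w i j y)%:E * v m j y)).
  apply: eq_bigr => i _; apply/esym/ge0_integral_sum => //.
  - exact: measurable_upray.
  - by move=> j; exact: mwv.
  - by move=> j y _; rewrite mule_ge0 ?lee_fin.
apply/esym/ge0_integral_sum => //.
- exact: measurable_upray.
- by move=> i; exact: mS.
- by move=> i y _; apply: sume_ge0 => j _; rewrite mule_ge0 ?lee_fin.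
Qed.

(** Only the finiteness demanded by [gronwall]; the bound obtained here may grow with [m]. *)
Let u_bounded m : exists L : R, forall x, u m x <= L%:E.
Proof.
elim: m => [|m [L uL]].
  exists 0%R => x; rewrite /u /v big1// => i _.
  by rewrite integral0_eq.
pose Q := fine (\int[mu]_y (W y)%:E).
have QE : \int[mu]_y (W y)%:E = Q%:E by rewrite fineK//; exact: integrable_fin_num iW.
have L0 : (0 <= L)%R by rewrite -lee_fin (le_trans _ (uL 0%R)).
exists (c + L * Q)%R => x; apply: le_trans (u_le m x) _.
rewrite EFinD; apply: leeD2l.
apply: (le_trans (@integral_le_sup _ _ W (u m) L _ _ _ _ _ _ _)) => //.
- exact: measurable_upray.
- by apply/measurable_EFinP; exact: measurable_int iW.
- rewrite EFinM -QE; apply: lee_wpmul2l; first by rewrite lee_fin.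
  apply: ge0_subset_integral => //.
  - exact: measurable_upray.
  - exact: measurable_int iW.
  - by move=> y _; rewrite lee_fin.
Qed.

Let At_bound : exists C : R, forall m i x, \int[mu]_t At m i (x, t) <= C%:E.
Proof.
have [C [C0 HC]] := gronwall _ W0 iW.
exists (C * c)%R => m i x.
apply: (@le_trans _ _ (u m x)).
  by rewrite /u (bigD1 i)//= leeDl// sume_ge0.
apply: (HC x) => //.
- by have [L uL] := u_bounded m; exists L => y _.
(* Monotonicity of the iteration closes the recursion: [u_m <= u_{m+1} <= c + \int W u_m], an
   inequality for [u_m] alone. *)
- move=> y _; apply: le_trans (u_le m y); apply: lee_sum => j _.
  apply: ge0_le_integral => //.
  - exact: (measurable_section1 _ _ (mAt m j)).
  - exact: (measurable_section1 _ _ (mAt m.+1 j)).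
Qed.

(** * The limit of the iteration *)

Let Ai i z := limn (fun m => At m i z).

Let cvgA i z : At m i z @[m --> \oo] --> Ai i z.
Proof. by apply: ereal_nondecreasing_is_cvgn; exact: At_nd. Qed.

Let mAi i : measurable_fun setT (Ai i).
Proof. by apply: (emeasurable_fun_cvg (fun m => At m i)) => // z _; exact: cvgA. Qed.

Let Ai_ge0 i z : 0 <= Ai i z.
Proof. by apply: lime_ge; [exact: cvgA|exact: nearW]. Qed.

Let Ai_supp i x t : (t < 0)%R -> Ai i (x, t) = 0.
Proof.
move=> t0; rewrite /Ai; under eq_fun do rewrite At_supp//.
exact: lim_cst.
Qed.

Let Ai_bound : exists C : R, forall i x, \int[mu]_t Ai i (x, t) <= C%:E.
Proof.
have [C HC] := At_bound; exists C => i x.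
have H : \int[mu]_t At m i (x, t) @[m --> \oo] --> \int[mu]_t Ai i (x, t).
  apply: cvg_monotone_convergence => // m.
  exact: (measurable_section1 _ _ (mAt m i)).
rewrite -(cvg_lim _ H)//; apply: lime_le; first by apply/cvg_ex; eexists; exact: H.
by apply: nearW.
Qed.

Let Ai_fix i z : Ai i z = picard Ai i z.
Proof.
have H : At m.+1 i z @[m --> \oo] --> picard Ai i z.
  have S0 (A : T -> R * R -> \bar R) j : (forall i z, 0 <= A i z) ->
      0 <= \int[mu]_(y in upray z.1) ((w i j y)%:E * A j (y, z.2 - a i * (y - z.1))%R).
    by move=> A0; apply: integral_ge0 => y _; rewrite mule_ge0 ?lee_fin.
  apply: cvgeD; first by rewrite ge0_adde_def// inE ?lee_fin ?sume_ge0// => j _; exact: S0.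
    exact: cvg_cst.
  apply: cvg_nnesum => [j _|j _]; first by apply: nearW => m; exact: S0.
  rewrite (_ : \int[mu]_(y in _) _ = \int[mu]_(y in upray z.1)
      limn (fun m => (w i j y)%:E * At m j (y, z.2 - a i * (y - z.1))%R)).
    apply: cvg_monotone_convergence.
    - exact: measurable_upray.
    - by move=> m; exact: measurable_term.
    - by move=> m y _; rewrite mule_ge0 ?lee_fin.
    - by move=> y _ m n mn; rewrite lee_wpmul2l ?lee_fin//; exact: At_nd.
  by apply: eq_integral => y _; rewrite limeMl//; exact: cvgA.
rewrite -(cvg_lim _ H)//; apply/esym/cvg_lim => //.
by rewrite (cvg_shiftS (fun m => At m i z)); exact: cvgA.
Qed.

(** Finite mass makes the limit finite for almost every [t], so replacing it by a real function
    leaves every integral in [t] unchanged. *)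
Let ae_fine i x : ae_eq mu setT (fun t => Ai i (x, t)) (fun t => (fine (Ai i (x, t)))%:E).
Proof.
have [C HC] := Ai_bound.
have : mu.-integrable setT (fun t => Ai i (x, t)).
  apply/integrableP; split; first exact: (measurable_section1 _ _ (mAi i)).
  under eq_integral do rewrite gee0_abs//.
  by apply: le_lt_trans (HC i x) _; rewrite ltry.
move=> /(integrable_ae measurableT); apply: filterS => t + _.
by move=> /(_ I) fA; rewrite fineK.
Qed.

Let integral_fine i x (h : R -> R) : measurable_fun setT h -> (forall t, 0 <= h t)%R ->
  \int[mu]_t ((h t)%:E * Ai i (x, t)) = \int[mu]_t (h t * fine (Ai i (x, t)))%:E.
Proof.
move=> mh h0.
have mA : measurable_fun setT (fun t => Ai i (x, t)).
  exact: (measurable_section1 _ _ (mAi i)).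
apply: ge0_ae_eq_integral => //.
- by apply: emeasurable_funM => //; exact/measurable_EFinP.
- apply/measurable_EFinP; apply: measurable_funM => //.
  exact: measurableT_comp.
- by move=> t _; rewrite mule_ge0 ?lee_fin.
- by move=> t _; rewrite lee_fin mulr_ge0// fine_ge0.
- by apply: filterS (ae_fine i x) => t + _ => /(_ I) {1}->; rewrite EFinM.
Qed.

(** The fixed point equation is recorded only against test functions: after infinite values are
    replaced by [0], it need not hold at every point, but its integrals survive. *)
Lemma nonneg_system : exists (A : T -> R -> R -> R) (C : R),
  [/\ forall i, measurable_fun setT (fun z : R * R => A i z.1 z.2),
      forall i x t, (0 <= A i x t)%R,
      forall i x t, (t < 0)%R -> A i x t = 0%R,
      forall i x, \int[mu]_t (A i x t)%:E <= C%:E &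
      forall (h : R -> R), measurable_fun setT h -> (forall t, 0 <= h t)%R ->
      forall i x, \int[mu]_t (h t * A i x t)%:E =
        \int[mu]_(y in upray x) (p i y * h (a i * (y - x)))%:E +
        \sum_j \int[mu]_(y in upray x) ((w i j y)%:E *
          \int[mu]_t (h (t + a i * (y - x)) * A j y t)%:E)].
Proof.
have [C HC] := Ai_bound.
exists (fun i x t => fine (Ai i (x, t))), C; split.
- move=> i; apply: measurableT_comp => //.
  by under eq_fun do rewrite -surjective_pairing; exact: mAi.
- by move=> i x t; rewrite fine_ge0.
- by move=> i x t t0; rewrite Ai_supp.
- move=> i x; apply: le_trans (HC i x).
  have := integral_fine i x (fun=> 1%R) (measurable_cst _) (fun=> ler01).
  under [X in X = _]eq_integral do rewrite mul1e.
  by under [X in _ = X]eq_integral do rewrite mul1r; move=> <-.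
- move=> h mh h0 i x; rewrite -integral_fine//.
  transitivity (\int[mu]_t ((h t)%:E * picard Ai i (x, t))).
    by apply: eq_integral => t _; rewrite Ai_fix.
  rewrite (integral_picard Ai mAi Ai_ge0 i x h mh h0).
  apply: f_equal2 => //; apply: eq_bigr => j _; apply: eq_integral => y _.
  congr (_ * _); apply: integral_fine => //.
  by apply: measurableT_comp => //; exact: measurable_funD.
Qed.

End nonneg_system.

(** * Complex-valued integrals *)

Section complex_integral.
Context {R : realType}.
Notation mu := (@lebesgue_measure R).
Notation C := R[i].
Notation Re := complex.Re.
Notation Im := complex.Im.
Implicit Types (z : C) (D : set R) (f g : R -> C).

Lemma ReD z z' : Re (z + z') = Re z + Re z'. Proof. by case: z z' => [? ?] []. Qed.
Lemma ImD z z' : Im (z + z') = Im z + Im z'. Proof. by case: z z' => [? ?] []. Qed.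
Lemma ReN z : Re (- z) = - Re z. Proof. by case: z. Qed.
Lemma ImN z : Im (- z) = - Im z. Proof. by case: z. Qed.
Lemma ReM z z' : Re (z * z') = Re z * Re z' - Im z * Im z'.
Proof. by case: z z' => [? ?] []. Qed.
Lemma ImM z z' : Im (z * z') = Re z * Im z' + Im z * Re z'.
Proof. by case: z z' => [? ?] []. Qed.

Lemma complex_eqP z z' : Re z = Re z' -> Im z = Im z' -> z = z'.
Proof. by case: z z' => [? ?] [? ?] /= -> ->. Qed.

Lemma Re_sum (I : Type) (s : seq I) (P : pred I) (F : I -> C) :
  Re (\sum_(i <- s | P i) F i) = \sum_(i <- s | P i) Re (F i).
Proof. exact: (big_morph _ ReD). Qed.
Lemma Im_sum (I : Type) (s : seq I) (P : pred I) (F : I -> C) :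
  Im (\sum_(i <- s | P i) F i) = \sum_(i <- s | P i) Im (F i).
Proof. exact: (big_morph _ ImD). Qed.

(* The l^1 norm of C = R^2: equivalent to the modulus and free of square roots. *)
Definition cnorm1 z : R := `|Re z| + `|Im z|.

Lemma cnorm1_ge0 z : 0 <= cnorm1 z. Proof. by rewrite addr_ge0. Qed.

Lemma cnorm10 : cnorm1 0 = 0. Proof. by rewrite /cnorm1 !normr0 addr0. Qed.

Lemma cnorm1_eq0 z : cnorm1 z <= 0 -> z = 0.
Proof.
rewrite /cnorm1 => z0.
have r0 := normr_ge0 (Re z); have i0 := normr_ge0 (Im z).
by apply: complex_eqP; apply/normr0_eq0; lra.
Qed.

Lemma cnorm1N z : cnorm1 (- z) = cnorm1 z.
Proof. by rewrite /cnorm1 ReN ImN !normrN. Qed.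

Lemma cnorm1D z z' : cnorm1 (z + z') <= cnorm1 z + cnorm1 z'.
Proof. by rewrite /cnorm1 ReD ImD addrACA lerD// ler_normD. Qed.

Lemma cnorm1M z z' : cnorm1 (z * z') <= cnorm1 z * cnorm1 z'.
Proof.
rewrite /cnorm1 ReM ImM; apply: (le_trans (lerD (ler_normB _ _) (ler_normD _ _))).
by rewrite !normrM; lra.
Qed.

Lemma cnorm1_sum (I : Type) (s : seq I) (P : pred I) (F : I -> C) :
  cnorm1 (\sum_(i <- s | P i) F i) <= \sum_(i <- s | P i) cnorm1 (F i).
Proof.
elim/big_ind2 : _ => //; first by rewrite cnorm10.
by move=> ? ? ? ? h1 h2; apply: le_trans (cnorm1D _ _) _; exact: lerD.
Qed.

Lemma cnorm1_cexpi (t : R) : cnorm1 (cexpi t) <= 2.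
Proof.
rewrite /cnorm1 /= (_ : 2 = 1 + 1)// lerD// ler_norml.
  by rewrite cos_geN1 cos_le1.
by rewrite sin_geN1 sin_le1.
Qed.

Lemma cexpiD (s t : R) : cexpi (s + t) = cexpi s * cexpi t.
Proof. by apply: complex_eqP; rewrite ?ReM ?ImM /= ?cosD ?sinD// addrC [cos s * _]mulrC. Qed.

Lemma cexpi0 : cexpi (0 : R) = 1.
Proof. by rewrite /cexpi cos0 sin0. Qed.

Lemma cexpiNK (t : R) : cexpi (- t) * cexpi t = 1.
Proof. by rewrite -cexpiD addNr cexpi0. Qed.

Definition cmeasurable d (S : measurableType d) (D : set S) (f : S -> C) : Prop :=
  measurable_fun D (fun s => Re (f s)) /\ measurable_fun D (fun s => Im (f s)).

Section cmeasurable.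
Context d (S : measurableType d) (D : set S).
Implicit Types F G : S -> C.

Lemma cmeasurable_cst z : cmeasurable d S D (fun=> z).
Proof. by split; exact: measurable_cst. Qed.

Lemma cmeasurableD F G :
  cmeasurable d S D F -> cmeasurable d S D G -> cmeasurable d S D (fun s => F s + G s).
Proof.
move=> [rF iF] [rG iG]; split.
  by under eq_fun do rewrite ReD; exact: measurable_funD.
by under eq_fun do rewrite ImD; exact: measurable_funD.
Qed.

Lemma cmeasurableN F : cmeasurable d S D F -> cmeasurable d S D (fun s => - F s).
Proof.
move=> [rF iF]; split.
  by under eq_fun do rewrite ReN; exact: measurable_funN.
by under eq_fun do rewrite ImN; exact: measurable_funN.
Qed.

Lemma cmeasurableM F G :
  cmeasurable d S D F -> cmeasurable d S D G -> cmeasurable d S D (fun s => F s * G s).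
Proof.
move=> [rF iF] [rG iG]; split.
  under eq_fun do rewrite ReM.
  by apply: measurable_funB; exact: measurable_funM.
under eq_fun do rewrite ImM.
by apply: measurable_funD; exact: measurable_funM.
Qed.

Lemma cmeasurable_sum (I : Type) (s : seq I) (F : I -> S -> C) :
  (forall i, cmeasurable d S D (F i)) ->
  cmeasurable d S D (fun x => \sum_(i <- s) F i x).
Proof.
move=> mF; split.
  under eq_fun do rewrite Re_sum.
  by apply: measurable_sum => i; case: (mF i).
under eq_fun do rewrite Im_sum.
by apply: measurable_sum => i; case: (mF i).
Qed.

Lemma measurable_cnorm1 F : cmeasurable d S D F -> measurable_fun D (fun s => cnorm1 (F s)).
Proof.
by move=> [rF iF]; apply: measurable_funD; exact: measurableT_comp.
Qed.

End cmeasurable.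

Lemma measurable_cos : measurable_fun setT (@cos R).
Proof. by apply: continuous_measurable_fun; exact: continuous_cos. Qed.

Lemma measurable_sin : measurable_fun setT (@sin R).
Proof. by apply: continuous_measurable_fun; exact: continuous_sin. Qed.

Lemma cmeasurable_cexpi d (S : measurableType d) (D : set S) (f : S -> R) :
  measurable_fun D f -> cmeasurable d S D (fun s => cexpi (f s)).
Proof.
move=> mf; split.
  exact: (measurableT_comp measurable_cos mf).
exact: (measurableT_comp measurable_sin mf).
Qed.

Notation cmeas D f := (cmeasurable _ (measurableTypeR R) D f).

Lemma cintegrable_measurable D f : cintegrable D f -> cmeas D f.
Proof. by move=> [/measurable_int/measurable_EFinP rf /measurable_int/measurable_EFinP]. Qed.

Lemma le_cintegrable D f (g : R -> R) : measurable D -> cmeas D f ->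
  (forall x, D x -> cnorm1 (f x) <= g x) -> mu.-integrable D (EFin \o g) ->
  cintegrable D f.
Proof.
move=> mD [rf jf] fg ig; split; apply: (le_integrable _ _ _ ig) => //.
- exact/measurable_EFinP.
- move=> x Dx /=; rewrite lee_fin (le_trans _ (ler_norm _))//.
  by apply: le_trans (fg _ Dx); rewrite lerDl.
- exact/measurable_EFinP.
- move=> x Dx /=; rewrite lee_fin (le_trans _ (ler_norm _))//.
  by apply: le_trans (fg _ Dx); rewrite lerDr.
Qed.

Lemma integrable_cnorm1 D f : measurable D -> cintegrable D f ->
  mu.-integrable D (EFin \o (fun x => cnorm1 (f x))).
Proof.
move=> mD [rf jf]; rewrite (_ : EFin \o _ = (fun x => `|(Re (f x))%:E| + `|(Im (f x))%:E|)%E).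
  by apply: integrableD => //; exact: integrable_abse.
by apply/funext => x.
Qed.

Lemma integrableZl_EFin D (h : R -> R) (k : R) : measurable D ->
  mu.-integrable D (EFin \o h) -> mu.-integrable D (EFin \o (fun x => k * h x)).
Proof.
move=> mD hi; rewrite (_ : EFin \o _ = (fun x => k%:E * (EFin \o h) x)%E); last exact/funext.
exact: integrableZl.
Qed.

Lemma cintegrableD D f g : measurable D -> cintegrable D f -> cintegrable D g ->
  cintegrable D (fun x => f x + g x).
Proof.
move=> mD [rf jf] [rg jg]; split.
  by under eq_fun do rewrite ReD EFinD; exact: integrableD.
by under eq_fun do rewrite ImD EFinD; exact: integrableD.
Qed.

Lemma cintegrableN D f : measurable D -> cintegrable D f -> cintegrable D (fun x => - f x).
Proof.
move=> mD [rf jf]; split.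
  by under eq_fun do rewrite ReN EFinN; exact: integrableN.
by under eq_fun do rewrite ImN EFinN; exact: integrableN.
Qed.

Lemma cintegrableM_bounded D f g (M : R) : measurable D -> cintegrable D f ->
  cmeas D g -> (forall x, D x -> cnorm1 (g x) <= M) ->
  cintegrable D (fun x => f x * g x).
Proof.
move=> mD fi mg gM.
apply: (le_cintegrable _ _ (fun x => M * cnorm1 (f x))) => //.
- by apply: cmeasurableM => //; exact: cintegrable_measurable.
- move=> x Dx; apply: le_trans (cnorm1M _ _) _; rewrite mulrC.
  by apply: ler_wpM2r; [exact: cnorm1_ge0|exact: gM].
- rewrite (_ : EFin \o _ = (fun x => M%:E * (cnorm1 (f x))%:E)%E); last exact/funext.
  by apply: integrableZl => //; exact: integrable_cnorm1.
Qed.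

Lemma cintegrableZ D f z : measurable D -> cintegrable D f -> cintegrable D (fun x => z * f x).
Proof.
move=> mD fi; under eq_fun do rewrite mulrC.
by apply: (cintegrableM_bounded _ _ _ (cnorm1 z)) => //; exact: cmeasurable_cst.
Qed.

Lemma cintegrable_sum (I : Type) (s : seq I) D (F : I -> R -> C) : measurable D ->
  (forall i, cintegrable D (F i)) -> cintegrable D (fun x => \sum_(i <- s) F i x).
Proof.
move=> mD Fi; elim: s => [|i s IH].
  by under eq_fun do rewrite big_nil; split => /=; exact: integrable0.
by under eq_fun do rewrite big_cons; exact: cintegrableD.
Qed.

Lemma eq_cint D f g : (forall x, D x -> f x = g x) -> cint D f = cint D g.
Proof.
move=> fg; rewrite /cint; congr (_ +i* _); apply: eq_Rintegral => x; rewrite inE => Dx.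
  by rewrite fg.
by rewrite fg.
Qed.

Lemma eq_cintegrable D f g : measurable D -> (forall x, D x -> f x = g x) ->
  cintegrable D f -> cintegrable D g.
Proof.
move=> mD fg [rf jf]; split.
  by apply: eq_integrable rf => // x; rewrite inE => Dx; rewrite fg.
by apply: eq_integrable jf => // x; rewrite inE => Dx; rewrite fg.
Qed.

Lemma cintD D f g : measurable D -> cintegrable D f -> cintegrable D g ->
  cint D (fun x => f x + g x) = cint D f + cint D g.
Proof.
move=> mD [rf jf] [rg jg]; apply: complex_eqP => /=.
  by under eq_Rintegral do rewrite ReD; exact: RintegralD.
by under eq_Rintegral do rewrite ImD; exact: RintegralD.
Qed.

Lemma cintZ D f z : measurable D -> cintegrable D f ->
  cint D (fun x => z * f x) = z * cint D f.
Proof.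
move=> mD [rf jf]; apply: complex_eqP; rewrite ?ReM ?ImM /=.
  under eq_Rintegral do rewrite ReM.
  rewrite RintegralB//; last 2 first.
  - exact: integrableZl_EFin.
  - exact: integrableZl_EFin.
  by rewrite !RintegralZl.
under eq_Rintegral do rewrite ImM.
rewrite RintegralD//; last 2 first.
- exact: integrableZl_EFin.
- exact: integrableZl_EFin.
by rewrite !RintegralZl.
Qed.

Lemma cintN D f : measurable D -> cintegrable D f -> cint D (fun x => - f x) = - cint D f.
Proof.
move=> mD fi; rewrite -mulN1r -cintZ//.
by apply: eq_cint => x _; rewrite mulN1r.
Qed.

Lemma cint0 D : cint D (fun=> 0) = 0.
Proof.
by apply: complex_eqP => /=; rewrite /Rintegral integral0_eq.
Qed.

Lemma cint_sum (I : Type) (s : seq I) D (F : I -> R -> C) : measurable D ->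
  (forall i, cintegrable D (F i)) ->
  cint D (fun x => \sum_(i <- s) F i x) = \sum_(i <- s) cint D (F i).
Proof.
move=> mD Fi; elim: s => [|i s IH].
  by rewrite big_nil -[RHS](cint0 D); apply: eq_cint => x _; rewrite big_nil.
rewrite big_cons -IH -cintD//; last exact: cintegrable_sum.
by apply: eq_cint => x _; rewrite big_cons.
Qed.

Lemma cnorm1_cint_le D f : measurable D -> cintegrable D f ->
  ((cnorm1 (cint D f))%:E <= \int[mu]_(x in D) (cnorm1 (f x))%:E)%E.
Proof.
move=> mD [rf jf]; rewrite /cnorm1 /= EFinD.
have -> : (\int[mu]_(x in D) (`|Re (f x)| + `|Im (f x)|)%:E =
   \int[mu]_(x in D) `|(Re (f x))%:E| + \int[mu]_(x in D) `|(Im (f x))%:E|)%E.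
  rewrite -ge0_integralD//.
    exact: (measurableT_comp _ (measurable_int _ rf)).
  exact: (measurableT_comp _ (measurable_int _ jf)).
apply: leeD.
  rewrite EFin_normr_Rintegral//; apply: le_abse_integral => //.
  exact: measurable_int rf.
rewrite EFin_normr_Rintegral//; apply: le_abse_integral => //.
exact: measurable_int jf.
Qed.

End complex_integral.

(** * Fourier transform of the nonnegative system *)

Section fourier_system.
Context {R : realType} {T : finType}.
Notation mu := (@lebesgue_measure R).
Notation C := R[i].
Notation Re := complex.Re.
Notation Im := complex.Im.
Variables (w : T -> T -> R -> R) (a : T -> R) (p : T -> R -> R).
Hypothesis iw : forall i j, mu.-integrable setT (EFin \o w i j).
Hypothesis ip : forall i, mu.-integrable setT (EFin \o p i).
Variables (A : T -> R -> R -> R) (B : R).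
Hypothesis mA : forall i, measurable_fun setT (fun z : R * R => A i z.1 z.2).
Hypothesis A0 : forall i x t, 0 <= A i x t.
Hypothesis AB : forall i x, (\int[mu]_t (A i x t)%:E <= B%:E)%E.
Hypothesis Aeq : forall h : R -> R, measurable_fun setT h -> (forall t, 0 <= h t) ->
  forall i x, (\int[mu]_t (h t * A i x t)%:E =
    \int[mu]_(y in upray x) (p i y * h (a i * (y - x)))%:E +
    \sum_j \int[mu]_(y in upray x) ((w i j y)%:E *
      \int[mu]_t (h (t + a i * (y - x)) * A j y t)%:E))%E.

Lemma integrableM_bounded (D : set R) (f b : R -> R) (M : R) : measurable D ->
  mu.-integrable D (EFin \o f) -> measurable_fun D b -> (forall x, `|b x| <= M) ->
  mu.-integrable D (EFin \o (fun x => f x * b x)).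
Proof.
move=> mD fi mb bM.
have M0 : 0 <= M by rewrite (le_trans _ (bM 0)).
apply: (@le_integrable _ _ _ mu _ _ _ (EFin \o (fun x => M * f x))) => //.
- apply/measurable_EFinP; apply: measurable_funM => //.
  by apply/measurable_EFinP; exact: measurable_int fi.
- move=> x Dx /=; rewrite lee_fin !normrM mulrC (ger0_norm M0).
  exact: ler_wpM2r.
- exact: integrableZl_EFin.
Qed.

Let mAx i x : measurable_fun setT (A i x).
Proof.
have mx : measurable_fun setT (fun t : R => (x, t)) by exact: measurable_fun_pair.
exact: (measurableT_comp (mA i) mx).
Qed.

Let iA i x : mu.-integrable setT (EFin \o A i x).
Proof.
apply/integrableP; split; first by apply/measurable_EFinP; exact: mAx.
rewrite [ltLHS](_ : _ = \int[mu]_t (A i x t)%:E)%E.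
  by apply: le_lt_trans (AB i x) _; rewrite ltry.
by apply: eq_integral => t _; rewrite /= ger0_norm.
Qed.

Let ihA i x (h : R -> R) (M : R) : measurable_fun setT h -> (forall t, `|h t| <= M) ->
  mu.-integrable setT (EFin \o (fun t => h t * A i x t)).
Proof.
move=> mh hM; under [X in EFin \o X]eq_fun do rewrite mulrC.
exact: (integrableM_bounded _ _ _ M).
Qed.

(** Pairing of a bounded test function with the density [A i x]; cosine and sine give the two parts
    of the Fourier transform. *)
Let V i x (h : R -> R) : R := Rintegral mu setT (fun t => h t * A i x t).

Let VB i x (h : R -> R) (M : R) : measurable_fun setT h -> (forall t, `|h t| <= M) ->
  `|V i x h| <= M * B.
Proof.
move=> mh hM.
have M0 : 0 <= M by rewrite (le_trans _ (hM 0)).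
have mhA : measurable_fun setT (fun t => h t * A i x t) by exact: measurable_funM.
apply: le_trans (le_normr_Rintegral _ _) _ => //; first exact: (ihA i x h M).
rewrite -lee_fin /Rintegral fineK; last first.
  apply: integrable_fin_num => //.
  have := integrable_norm (ihA i x h M mh hM); exact.
apply: (@le_trans _ _ (\int[mu]_t (M%:E * (A i x t)%:E))%E).
  apply: ge0_le_integral => //.
  - by apply/measurable_EFinP; apply: measurableT_comp => //; exact: mhA.
  - by apply: emeasurable_funM => //; apply/measurable_EFinP; exact: mAx.
  - move=> t _; rewrite -EFinM lee_fin normrM (ger0_norm (A0 _ _ _)).
    exact: ler_wpM2r.
rewrite ge0_integralZl//; last 2 first.
- exact: measurable_int (iA i x).
- by move=> t _; rewrite lee_fin.
by rewrite EFinM lee_wpmul2l ?lee_fin.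
Qed.

Let VBr i x (h h' : R -> R) (M M' : R) :
  measurable_fun setT h -> (forall t, `|h t| <= M) ->
  measurable_fun setT h' -> (forall t, `|h' t| <= M') ->
  V i x (fun t => h t - h' t) = V i x h - V i x h'.
Proof.
move=> mh hM mh' hM'; rewrite /V -RintegralB//; last 2 first.
- exact: (ihA i x h M).
- exact: (ihA i x h' M').
by apply: eq_Rintegral => t _; rewrite mulrBl.
Qed.

(** Tonelli gives measurability of parameter integrals for nonnegative integrands; adding the
    constant [M] to [H] reduces to that case. *)
Let mV j (H : R * R -> R) (M : R) : measurable_fun setT H -> (forall z, `|H z| <= M) ->
  measurable_fun setT (fun y : R => V j y (fun t => H (y, t))).
Proof.
move=> mH HM.
have HP (G : R * R -> R) : measurable_fun setT G -> (forall z, 0 <= G z) ->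
    measurable_fun setT (fun y : R => V j y (fun t => G (y, t))).
  move=> mG G0; apply: measurableT_comp => //.
  apply: (measurable_integral2 (fun z => (G z * A j z.1 z.2)%:E)).
    by apply/measurable_EFinP; exact: measurable_funM.
  by move=> z; rewrite lee_fin mulr_ge0.
have M0 : 0 <= M by rewrite (le_trans _ (HM (0, 0))).
have mHs y : measurable_fun setT (fun t => H (y, t)).
  by apply: (measurableT_comp mH); exact: measurable_fun_pair.
rewrite (_ : (fun y => _) = (fun y => V j y (fun t => H (y, t) + M) - V j y (fun=> M))).
  apply: measurable_funB.
    apply: (HP (fun z => H z + M)); first exact: measurable_funD.
    by move=> z; have := HM z; rewrite ler_norml => /andP[]; lra.
  exact: (HP (fun=> M)).
apply/funext => y; rewrite -(VBr _ _ _ _ (M + M) M)//.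
- by congr (V _ _ _); apply/funext => t; rewrite addrK.
- exact: measurable_funD.
- by move=> t; apply: le_trans (ler_normD _ _) _; rewrite (ger0_norm M0) lerD2r.
- by move=> t; rewrite ger0_norm.
Qed.

Let msh i x : measurable_fun setT (fun y : R => a i * (y - x)).
Proof. by apply: measurable_funM => //; exact: measurable_funB. Qed.

Let mshift i x (h : R -> R) : measurable_fun setT h ->
  measurable_fun setT (fun z : R * R => h (z.2 + a i * (z.1 - x))).
Proof.
move=> mh; apply: measurableT_comp => //; apply: measurable_funD => //.
by apply: measurable_funM => //; exact: measurable_funB.
Qed.

Let iwV i j x (h : R -> R) (M : R) : measurable_fun setT h -> (forall t, `|h t| <= M) ->
  mu.-integrable (upray x) (EFin \o (fun y => w i j y * V j y (fun t => h (t + a i * (y - x))))).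
Proof.
move=> mh hM; apply: (@integrableS _ _ _ mu setT) => //; first exact: measurable_upray.
apply: (integrableM_bounded _ _ _ (M * B)) => //.
  exact: (mV j (fun z => h (z.2 + a i * (z.1 - x))) M (mshift _ _ _ mh)).
move=> y; apply: VB => //.
by apply: measurableT_comp => //; exact: measurable_funD.
Qed.

Let iph i x (h : R -> R) (M : R) : measurable_fun setT h -> (forall t, `|h t| <= M) ->
  mu.-integrable (upray x) (EFin \o (fun y => p i y * h (a i * (y - x)))).
Proof.
move=> mh hM; apply: (@integrableS _ _ _ mu setT) => //; first exact: measurable_upray.
apply: (integrableM_bounded _ _ _ M) => //.
exact: measurableT_comp.
Qed.

(** Boundedness of [h] makes every extended integral in [Aeq] finite, so the identity descends to
    real numbers. *)
Let V_eq_ge0 i x (h : R -> R) (M : R) : measurable_fun setT h -> (forall t, 0 <= h t <= M) ->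
  V i x h = Rintegral mu (upray x) (fun y => p i y * h (a i * (y - x))) +
    \sum_j Rintegral mu (upray x) (fun y => w i j y * V j y (fun t => h (t + a i * (y - x)))).
Proof.
move=> mh h0M.
have h0 t : 0 <= h t by case/andP: (h0M t).
have hM t : `|h t| <= M by rewrite ger0_norm//; case/andP: (h0M t).
apply: EFin_inj; rewrite EFinD -sumEFin /V /Rintegral fineK; last first.
  exact: integrable_fin_num (ihA i x h M mh hM).
rewrite (Aeq h mh h0); apply: f_equal2.
  by rewrite fineK//; apply: integrable_fin_num (iph i x h M mh hM); exact: measurable_upray.
apply: eq_bigr => j _; rewrite fineK; last first.
  by apply: integrable_fin_num (iwV i j x h M mh hM); exact: measurable_upray.
apply: eq_integral => y _; rewrite [RHS]EFinM fineK//.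
apply: integrable_fin_num => //; apply: (ihA j y (fun t => h (t + a i * (y - x))) M) => //.
by apply: measurableT_comp => //; exact: measurable_funD.
Qed.

(* Reduced to the nonnegative case by writing [h] as [(h + 1) - 1]. *)
Let V_eq i x (h : R -> R) : measurable_fun setT h -> (forall t, `|h t| <= 1) ->
  V i x h = Rintegral mu (upray x) (fun y => p i y * h (a i * (y - x))) +
    \sum_j Rintegral mu (upray x) (fun y => w i j y * V j y (fun t => h (t + a i * (y - x)))).
Proof.
move=> mh h1.
pose h' t := h t + 1.
have mh' : measurable_fun setT h' by exact: measurable_funD.
have h'2 t : 0 <= h' t <= 2.
  by rewrite /h'; have := h1 t; rewrite ler_norml => /andP[]; lra.
have nh'2 t : `|h' t| <= 2 by rewrite ger0_norm; case/andP: (h'2 t).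
have n1 (t : R) : `|1| <= 1 :> R by rewrite normr1.
have mup := measurable_upray x.
have VE j y (b : R) : V j y (fun t => h (t + b)) = V j y (fun t => h' (t + b)) - V j y (fun=> 1).
  rewrite -(VBr _ _ _ _ 2 1)//.
  - by congr (V _ _ _); apply/funext => t; rewrite /h' addrK.
  - by apply: measurableT_comp => //; exact: measurable_funD.
have -> : V i x h = V i x h' - V i x (fun=> 1).
  by rewrite -(VBr _ _ _ _ 2 1)//; congr (V _ _ _); apply/funext => t; rewrite /h' addrK.
rewrite (V_eq_ge0 i x h' 2)// (V_eq_ge0 i x (fun=> 1) 1)//; last first.
  by move=> t; rewrite ler01 lexx.
rewrite opprD addrACA; congr (_ + _).
  rewrite -RintegralB//; last 2 first.
  - exact: (iph i x h' 2).
  - exact: (iph i x (fun=> 1) 1).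
  by apply: eq_Rintegral => y _; rewrite /h' -mulrBr addrK.
rewrite -sumrB; apply: eq_bigr => j _.
rewrite -RintegralB//; last 2 first.
- exact: (iwV i j x h' 2).
- exact: (iwV i j x (fun=> 1) 1).
by apply: eq_Rintegral => y _; rewrite VE [RHS]mulrBr.
Qed.

(** * The transform at a fixed frequency *)

Section fourier.
Variable k : R.

Definition fourier i x : C := cint setT (fun t => cexpi (k * t) * (A i x t)%:C).

Let mck : measurable_fun setT (fun t : R => cos (k * t)).
Proof. by apply: (measurableT_comp measurable_cos); exact: mulrl_measurable. Qed.

Let msk : measurable_fun setT (fun t : R => sin (k * t)).
Proof. by apply: (measurableT_comp measurable_sin); exact: mulrl_measurable. Qed.

Let cos1 (t : R) : `|cos t| <= 1. Proof. by rewrite ler_norml cos_geN1 cos_le1. Qed.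
Let sin1 (t : R) : `|sin t| <= 1. Proof. by rewrite ler_norml sin_geN1 sin_le1. Qed.

Let Re_fourier i x : Re (fourier i x) = V i x (fun t => cos (k * t)).
Proof. by apply: eq_Rintegral => t _; rewrite ReM /= mulr0 subr0. Qed.

Let Im_fourier i x : Im (fourier i x) = V i x (fun t => sin (k * t)).
Proof. by apply: eq_Rintegral => t _; rewrite ImM /= mulr0 add0r. Qed.

Lemma cintegrable_fourier i x : cintegrable setT (fun t => cexpi (k * t) * (A i x t)%:C).
Proof.
split.
  under eq_fun do rewrite ReM /= mulr0 subr0.
  exact: (ihA i x (fun t => cos (k * t)) 1).
under eq_fun do rewrite ImM /= mulr0 add0r.
exact: (ihA i x (fun t => sin (k * t)) 1).
Qed.

Lemma cmeasurable_fourier i : cmeasurable _ R setT (fourier i).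
Proof.
split.
  under eq_fun do rewrite Re_fourier.
  apply: (mV i (fun z => cos (k * z.2)) 1) => //.
  apply: (measurableT_comp measurable_cos); exact: measurable_funM.
under eq_fun do rewrite Im_fourier.
apply: (mV i (fun z => sin (k * z.2)) 1) => //.
apply: (measurableT_comp measurable_sin); exact: measurable_funM.
Qed.

Lemma cnorm1_fourier i x : cnorm1 (fourier i x) <= B + B.
Proof.
by rewrite /cnorm1 Re_fourier Im_fourier lerD// -[B]mul1r VB.
Qed.

(** Translating the cosine mixes it with the sine; the pair is closed under translation, which acts
    on the complex transform as a phase. *)
Let Vcos j y (b : R) : V j y (fun t => cos (k * (t + b))) = Re (cexpi (k * b) * fourier j y).
Proof.
rewrite -cintZ//; last exact: cintegrable_fourier.
apply: eq_Rintegral => t _; rewrite mulrA -cexpiD ReM /= mulr0 subr0.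
by rewrite mulrDr addrC.
Qed.

Let Vsin j y (b : R) : V j y (fun t => sin (k * (t + b))) = Im (cexpi (k * b) * fourier j y).
Proof.
rewrite -cintZ//; last exact: cintegrable_fourier.
apply: eq_Rintegral => t _; rewrite mulrA -cexpiD ImM /= mulr0 add0r.
by rewrite mulrDr addrC.
Qed.

Lemma cintegrable_fourier_source i x :
  cintegrable (upray x) (fun y => (p i y)%:C * cexpi (k * (a i * (y - x)))).
Proof.
split.
  under eq_fun do rewrite ReM /= mul0r subr0.
  exact: (iph i x (fun t => cos (k * t)) 1).
under eq_fun do rewrite ImM /= mul0r addr0.
exact: (iph i x (fun t => sin (k * t)) 1).
Qed.

Lemma cintegrable_fourier_term i j x :
  cintegrable (upray x) (fun y => (w i j y)%:C * (cexpi (k * (a i * (y - x))) * fourier j y)).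
Proof.
split.
  under eq_fun do rewrite ReM [Im _%:C]/= mul0r subr0 -Vcos.
  exact: (iwV i j x (fun t => cos (k * t)) 1).
under eq_fun do rewrite ImM [Im _%:C]/= mul0r addr0 -Vsin.
exact: (iwV i j x (fun t => sin (k * t)) 1).
Qed.

Lemma fourier_eq i x : fourier i x =
  cint (upray x) (fun y => (p i y)%:C * cexpi (k * (a i * (y - x)))) +
  \sum_j cint (upray x) (fun y => (w i j y)%:C * (cexpi (k * (a i * (y - x))) * fourier j y)).
Proof.
apply: complex_eqP.
  rewrite Re_fourier V_eq// ReD Re_sum; congr (_ + _).
    by apply: eq_Rintegral => y _; rewrite ReM /= mul0r subr0.
  apply: eq_bigr => j _; apply: eq_Rintegral => y _.
  by rewrite ReM [Im _%:C]/= mul0r subr0 -Vcos.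
rewrite Im_fourier V_eq// ImD Im_sum; congr (_ + _).
  by apply: eq_Rintegral => y _; rewrite ImM /= mul0r addr0.
apply: eq_bigr => j _; apply: eq_Rintegral => y _.
by rewrite ImM [Im _%:C]/= mul0r addr0 -Vsin.
Qed.

End fourier.
End fourier_system.

(** * Uniqueness for Volterra systems *)

Section volterra.
Context {R : realType} {T : finType}.
Notation mu := (@lebesgue_measure R).
Notation C := R[i].
Variables (Q : T -> T -> R -> C) (e : T -> R -> R -> C) (d : T -> C).
Hypothesis iQ : forall i l, cintegrable setT (Q i l).
Hypothesis me : forall i x, cmeasurable _ R setT (e i x).
Hypothesis e2 : forall i x y, cnorm1 (e i x y) <= 2.

(** The regularity asked for is weak enough to be met both by the Jost solution and by the transform
    of the constructed kernel. *)
Definition volterra_solution (m : T -> R -> C) : Prop :=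
  [/\ forall i, cmeasurable _ R setT (m i),
      forall i x, cintegrable (upray x) (fun y => \sum_l Q i l y * m l y) &
      forall i x, m i x =
        d i - cint (upray x) (fun y => e i x y * \sum_l Q i l y * m l y)].

Let ie (G : R -> C) i x : cintegrable (upray x) G ->
  cintegrable (upray x) (fun y => e i x y * G y).
Proof.
move=> iG; under eq_fun do rewrite mulrC.
apply: (cintegrableM_bounded _ _ _ 2) => //; first exact: measurable_upray.
case: (me i x) => r c; split; apply: (@measurable_funS _ _ _ _ setT) => //.
Qed.

(** Integrability of [Q m] on the half-line bounds the integral term uniformly to the right of [x0].
    This supplies the a priori bound for [gronwall], including near [+oo]. *)
Lemma volterra_bounded m x0 : volterra_solution m ->
  exists L : R, forall i x, x0 <= x -> cnorm1 (m i x) <= L.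
Proof.
move=> [mm im mE].
pose G i y := \sum_l Q i l y * m l y.
pose I i := fine (\int[mu]_(y in upray x0) (cnorm1 (G i y))%:E).
have mup := @measurable_upray R.
have I0 i : 0 <= I i.
  by apply/fine_ge0/integral_ge0 => y _; rewrite lee_fin cnorm1_ge0.
have IE i : (\int[mu]_(y in upray x0) (cnorm1 (G i y))%:E)%E = (I i)%:E.
  rewrite fineK//.
  by apply: integrable_fin_num (integrable_cnorm1 _ _ (mup x0) (im i x0)); exact: mup.
exists (\sum_i (cnorm1 (d i) + 2 * I i)) => i x x0x.
have le1 : cnorm1 (m i x) <= cnorm1 (d i) + 2 * I i.
  rewrite mE; apply: le_trans (cnorm1D _ _) _; rewrite cnorm1N lerD2l -lee_fin.
  apply: le_trans (cnorm1_cint_le _ _ (mup x) (ie _ _ _ (im i x))) _.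
  have mG : measurable_fun (upray x0) (fun y => cnorm1 (G i y)).
    exact: measurable_cnorm1 (cintegrable_measurable _ _ (im i x0)).
  have sub : upray x `<=` upray x0 by move=> y; exact: le_trans.
  have mGx : measurable_fun (upray x) (fun y => cnorm1 (G i y)).
    by apply: measurable_funS mG => //; exact: mup.
  apply: (@le_trans _ _ (\int[mu]_(y in upray x) (2%:E * (cnorm1 (G i y))%:E))%E).
    apply: ge0_le_integral => //; first exact: mup.
    - by move=> y _; rewrite lee_fin cnorm1_ge0.
    - apply/measurable_EFinP; apply: measurable_cnorm1.
      exact: cintegrable_measurable (ie _ _ _ (im i x)).
    - by apply: emeasurable_funM => //; exact/measurable_EFinP.
    - move=> y _; rewrite -EFinM lee_fin; apply: le_trans (cnorm1M _ _) _.
      by apply: ler_wpM2r; [exact: cnorm1_ge0|exact: e2].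
  rewrite ge0_integralZl//; last 3 first.
  - exact: mup.
  - exact/measurable_EFinP.
  - by move=> y _; rewrite lee_fin cnorm1_ge0.
  rewrite EFinM; apply: lee_wpmul2l => //; rewrite -IE.
  apply: ge0_subset_integral => //.
  - exact: mup.
  - exact: mup.
  - exact/measurable_EFinP.
  - by move=> y _; rewrite lee_fin cnorm1_ge0.
apply: le_trans le1 _; rewrite (bigD1 i)//= lerDl sumr_ge0// => l _.
by rewrite addr_ge0 ?cnorm1_ge0// mulr_ge0.
Qed.

Lemma volterra_unique m m' : volterra_solution m -> volterra_solution m' ->
  forall i x, m i x = m' i x.
Proof.
move=> sm sm'; have [mm im mE] := sm; have [mm' im' mE'] := sm'.
pose D i y := m i y - m' i y.
have mD i : cmeasurable _ R setT (D i).
  by apply: cmeasurableD => //; exact: cmeasurableN.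
have mup := @measurable_upray R.
pose G i y := \sum_l Q i l y * D l y.
have GE i y : G i y = \sum_l Q i l y * m l y - \sum_l Q i l y * m' l y.
  by rewrite /G -sumrB; apply: eq_bigr => l _; rewrite mulrBr.
have iG i x : cintegrable (upray x) (G i).
  apply: (eq_cintegrable _ _ _ (mup x) (fun y _ => esym (GE i y))).
  by apply: cintegrableD => //; apply: cintegrableN => //; exact: mup.
have DE i x : D i x = - cint (upray x) (fun y => e i x y * G i y).
  rewrite /D mE mE' [X in _ = - X](eq_cint _ _ (fun y => e i x y * (\sum_l Q i l y * m l y) +
    - (e i x y * \sum_l Q i l y * m' l y))); last by move=> y _; rewrite GE mulrBr.
  rewrite cintD ?cintN; [ring| | | | |].
  - exact: mup.
  - exact: ie.
  - exact: mup.
  - exact: ie.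
  - by apply: cintegrableN; [exact: mup|exact: ie].
(* The factor [2] is the bound on [cnorm1] of the phases [e]. *)
pose W y := \sum_i \sum_l 2 * cnorm1 (Q i l y).
have W0 y : 0 <= W y.
  by apply: sumr_ge0 => i _; apply: sumr_ge0 => l _; rewrite mulr_ge0// cnorm1_ge0.
have iW : mu.-integrable setT (EFin \o W).
  rewrite (_ : EFin \o W = fun y => (\sum_i \sum_l (2 * cnorm1 (Q i l y))%:E)%E).
    apply: integrable_sum => // i _; apply: integrable_sum => // l _.
    apply: integrableZl_EFin => //; exact: integrable_cnorm1.
  by apply/funext => y; rewrite /= /W -sumEFin; apply: eq_bigr => i _; rewrite sumEFin.
pose u y := (\sum_i (cnorm1 (D i y))%:E)%E.
have uE y : u y = (\sum_i cnorm1 (D i y))%:E by rewrite /u sumEFin.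
have mu_ : measurable_fun setT u.
  apply: emeasurable_sum => i; apply/measurable_EFinP.
  exact: measurable_cnorm1.
have u0 y : (0 <= u y)%E by apply: sume_ge0 => i _; rewrite lee_fin cnorm1_ge0.
have [K [K0 HK]] := gronwall _ W0 iW.
move=> i x; apply/subr0_eq/cnorm1_eq0; rewrite -[_ - _]/(D i x).
have : (u x <= (K * 0)%:E)%E.
  apply: (HK x 0 u) => //.
    have [L HL] := volterra_bounded m x sm; have [L' HL'] := volterra_bounded m' x sm'.
    exists (\sum_(i : T) (L + L')) => y xy; rewrite uE lee_fin; apply: ler_sum => l _.
    apply: le_trans (cnorm1D _ _) _; rewrite cnorm1N.
    by apply: lerD; [exact: HL|exact: HL'].
  move=> y _; rewrite add0e.
  have mint l : measurable_fun (upray y) (fun z => (cnorm1 (e l y z * G l z))%:E).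
    apply/measurable_EFinP; apply: measurable_cnorm1.
    exact: cintegrable_measurable (ie _ _ _ (iG l y)).
  apply: (@le_trans _ _ (\sum_l \int[mu]_(z in upray y) (cnorm1 (e l y z * G l z))%:E)%E).
    apply: lee_sum => l _; rewrite DE cnorm1N.
    exact: cnorm1_cint_le _ _ (mup y) (ie _ _ _ (iG l y)).
  rewrite (_ : (\sum_l _ = \int[mu]_(z in upray y) \sum_l (cnorm1 (e l y z * G l z))%:E)%E); last first.
    apply/esym/ge0_integral_sum => //.
    - exact: mup.
    - by move=> l z _; rewrite lee_fin cnorm1_ge0.
  apply: ge0_le_integral => //.
  - exact: mup.
  - by move=> z _; apply: sume_ge0 => l _; rewrite lee_fin cnorm1_ge0.
  - by apply: emeasurable_sum => l; exact: mint.
  - apply: (@measurable_funS _ _ _ _ setT) => //; apply: emeasurable_funM => //.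
    exact: measurable_int iW.
  - move=> z _; rewrite uE -EFinM sumEFin lee_fin /W mulr_suml.
    apply: ler_sum => l _; apply: le_trans (cnorm1M _ _) _.
    apply: (@le_trans _ _ (2 * cnorm1 (G l z))).
      by apply: ler_wpM2r; [exact: cnorm1_ge0|exact: e2].
    apply: (@le_trans _ _ (2 * \sum_s cnorm1 (Q l s z) * cnorm1 (D s z))).
      rewrite ler_wpM2l//; apply: le_trans (cnorm1_sum _ _ _ _) _.
      by apply: ler_sum => s _; exact: cnorm1M.
    rewrite mulr_sumr mulr_suml; apply: ler_sum => s _; rewrite mulrA.
    apply: ler_wpM2l; first by rewrite mulr_ge0// cnorm1_ge0.
    by rewrite (bigD1 s)//= lerDl sumr_ge0// => t _; exact: cnorm1_ge0.
rewrite mulr0 uE lee_fin; apply: le_trans.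
by rewrite (bigD1 i)//= lerDl sumr_ge0// => t _; exact: cnorm1_ge0.
Qed.

End volterra.

(** * Kernels of the columns of the Jost matrix *)

Section quarter_parts.
Context {R : realType}.
Notation mu := (@lebesgue_measure R).
Notation C := R[i].
Notation Re := complex.Re.
Notation Im := complex.Im.

(* Decomposing C over the cone generated by 1, i, -1 and -i turns a complex linear system into
   one with nonnegative coefficients. *)
Definition cpart (r : 'I_4) (z : C) : R := Num.max (Re ((- 'i) ^+ r * z)) 0.

Lemma cpart_ge0 r z : 0 <= cpart r z.
Proof. by rewrite /cpart le_max lexx orbT. Qed.

Lemma cpart0 r : cpart r 0 = 0.
Proof. by rewrite /cpart mulr0 maxxx. Qed.

Lemma maxrN_sub (x : R) : Num.max x 0 - Num.max (- x) 0 = x.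
Proof.
by rewrite /Num.max; case: ltP => x0; case: ltP => x1; lra.
Qed.

(** The parts [0] and [2] are the positive and negative parts of the real part, and [1] and [3]
    those of the imaginary part. *)
Lemma cpart_sum (z : C) : \sum_(r < 4) 'i ^+ r * (cpart r z)%:C = z.
Proof.
rewrite !big_ord_recl big_ord0 /cpart /=.
case: z => x y; apply: complex_eqP; rewrite /bump /= !(mul0r, mulr0, mul1r, mulr1, oppr0,
  subr0, add0r, addr0, mulN1r, mulrN1, opprK, sub0r, mulNr); exact: maxrN_sub.
Qed.

Lemma integrable_cpart (D : set R) r (f : R -> C) : measurable D -> cintegrable D f ->
  mu.-integrable D (EFin \o (fun y => cpart r (f y))).
Proof.
move=> mD fi; have [rf _] := cintegrableZ _ _ ((- 'i) ^+ r) mD fi.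
rewrite (_ : (fun y => cpart r (f y)) = (fun y => Re ((- 'i) ^+ r * f y))^\+).
  exact: integrable_funrpos.
exact/funext.
Qed.

End quarter_parts.

(** * Passage from the delay [t >= 0] to the variable [y = x + t] *)

Section shifted_integral.
Context {R : realType}.
Notation mu := (@lebesgue_measure R).
Notation C := R[i].

Let shift (x : R) : R -> measurableTypeR R := fun y => y + - x.

Let mshift x : measurable_fun setT (shift x).
Proof. exact: measurable_funD. Qed.

Let shift_upray x : shift x @^-1` (upray 0) = upray x.
Proof. by apply/seteqP; split => y; rewrite /upray /shift /= subr_ge0. Qed.

Let integral_upray0 (f : R -> \bar R) : (forall t, t < 0 -> f t = 0%E) ->
  (\int[mu]_(t in upray 0) f t = \int[mu]_t f t)%E.
Proof.
move=> f0; rewrite integral_upray; apply: eq_integral => t _.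
by rewrite /heaviside; case: (lerP 0 t) => [|/f0 ->]; rewrite ?mul1e ?mul0e.
Qed.

(** The translation carries [[x, +oo[] to [[0, +oo[], and the support condition extends that
    integral to the whole line. *)
Lemma integral_shift x (f : R -> \bar R) : measurable_fun setT f ->
  (forall t, t < 0 -> f t = 0%E) ->
  (\int[mu]_(y in upray x) f (y - x)%R = \int[mu]_t f t)%E.
Proof.
move=> mf f0; rewrite -integral_upray0// -(shift_upray x).
apply: (integral_preserving (shift x) (mshift x) (lebesgue_measure_shift (- x))).
  exact: measurable_upray.
exact: measurable_funS mf.
Qed.

Lemma integrable_shift x (f : R -> \bar R) : mu.-integrable setT f ->
  mu.-integrable (upray x) (fun y => f (y - x)).
Proof.
move=> fi; rewrite -(shift_upray x).
apply: (integrable_preserving (shift x) (mshift x) (lebesgue_measure_shift (- x)) _ f).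
  exact: measurable_upray.
by apply: (@integrableS _ _ _ mu setT) => //; exact: measurable_upray.
Qed.

Lemma cintegrable_shift x (f : R -> C) : cintegrable setT f ->
  cintegrable (upray x) (fun y => f (y - x)).
Proof.
move=> [rf jf]; split.
  exact: (integrable_shift x _ rf).
exact: (integrable_shift x _ jf).
Qed.

Lemma cint_shift x (f : R -> C) : cintegrable setT f -> (forall t, t < 0 -> f t = 0) ->
  cint (upray x) (fun y => f (y - x)) = cint setT f.
Proof.
move=> [rf jf] f0; apply: complex_eqP => /=; rewrite /Rintegral; congr fine.
  apply: (integral_shift x (fun t => (complex.Re (f t))%:E)); last by move=> t /f0 ->.
  exact: measurable_int rf.
apply: (integral_shift x (fun t => (complex.Im (f t))%:E)); last by move=> t /f0 ->.
exact: measurable_int jf.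
Qed.

Lemma cnorm1_iX (r : nat) (z : C) : cnorm1 ('i ^+ r * z) = cnorm1 z.
Proof.
elim: r z => [|r IH] z; first by rewrite expr0 mul1r.
rewrite exprSr -mulrA IH /cnorm1 ReM ImM /= !(mul0r, mul1r, add0r) normrN.
by rewrite addrC.
Qed.

End shifted_integral.

(** * One column of the Jost matrix with [sigma j] equal to [1] or [-1] *)

Section column.
Context {R : realType} {mp mm : nat}.
Notation mu := (@lebesgue_measure R).
Notation C := R[i].
Notation n := (mp + 1 + mm)%N.
Variable Q : R -> 'M[C]_n.
Hypothesis aQ : admissible_potential Q.
Variable j : 'I_n.
Hypothesis sj : sigma R j * sigma R j = 1.

(** The unknown with index [(i, r)] is the nonnegative coefficient of [i^r] in the entry [i] of the
    kernel column. *)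
Let T : finType := ('I_n * 'I_4)%type.
Let a (i : 'I_n) : R := 1 - sigma R j * sigma R i.

Let a_ge0 i : 0 <= a i.
Proof.
rewrite /a /sigma.
by case: ifP => _; [|case: ifP => _]; (case: ifP => _; [|case: ifP => _]); lra.
Qed.

(** As [sigma j] is [1] or [-1], [a i = 0] forces [sigma i = sigma j], and the value of [sigma]
    determines the block. *)
Let a_eq0 i : a i = 0 -> blk i = blk j.
Proof.
move: sj; rewrite /a /sigma /blk.
by case: ifP => _; [|case: ifP => _]; (case: ifP => _; [|case: ifP => _]) => //;
  move=> h1 h2; exfalso; lra.
Qed.

Let iQ i l : cintegrable setT (fun y => Q y i l).
Proof. by case: aQ => _; apply. Qed.

(** The part along [i^r] of what a unit coefficient of [i^{r'}] in entry [l] contributes to entry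
    [i]. The minus sign of the Volterra equation sits inside [cpart], so the coefficient stays
    nonnegative. *)
Let w (i l : T) (y : R) : R := cpart i.2 (- 'i ^+ l.2 * Q y i.1 l.1).
Let p (i : T) (y : R) : R := cpart i.2 (- Q y i.1 j).

Let iw i l : mu.-integrable setT (EFin \o w i l).
Proof. by apply: integrable_cpart => //; exact: cintegrableZ. Qed.

Let ip i : mu.-integrable setT (EFin \o p i).
Proof. by apply: integrable_cpart => //; exact: cintegrableN. Qed.

Let p_eq0 (i : T) y : a i.1 = 0 -> p i y = 0.
Proof. by move=> /a_eq0 b; rewrite /p; case: aQ => -> //; rewrite oppr0 cpart0. Qed.

Section kernel.
Variables (A : T -> R -> R -> R) (B : R).
Hypothesis mA : forall i, measurable_fun setT (fun z : R * R => A i z.1 z.2).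
Hypothesis A0 : forall i x t, 0 <= A i x t.
Hypothesis Asupp : forall i x t, t < 0 -> A i x t = 0.
Hypothesis AB : forall i x, (\int[mu]_t (A i x t)%:E <= B%:E)%E.
Hypothesis Aeq : forall h : R -> R, measurable_fun setT h -> (forall t, 0 <= h t) ->
  forall i x, (\int[mu]_t (h t * A i x t)%:E =
    \int[mu]_(y in upray x) (p i y * h (a i.1 * (y - x)))%:E +
    \sum_l \int[mu]_(y in upray x) ((w i l y)%:E *
      \int[mu]_t (h (t + a i.1 * (y - x)) * A l y t)%:E))%E.

Variable k : R.
Let kj := sigma R j * k.
Let e (i : 'I_n) (x y : R) : C := cexpi (kj * (a i * (y - x))).
Let F := fourier A kj.
Let Bh (i : 'I_n) x : C := \sum_(r < 4) 'i ^+ r * F (i, r) x.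
Let M (i : 'I_n) x : C := (i == j)%:R + Bh i x.
Let q (i l : 'I_n) (y : R) : C := Q y i l.

Let me i x : cmeasurable _ R setT (e i x).
Proof.
apply: cmeasurable_cexpi; apply: measurable_funM => //; apply: measurable_funM => //.
exact: measurable_funB.
Qed.

Let mF i : cmeasurable _ R setT (F i).
Proof. exact: (cmeasurable_fourier A B). Qed.

Let mM i : cmeasurable _ R setT (M i).
Proof.
apply: cmeasurableD; first exact: cmeasurable_cst.
apply: cmeasurable_sum => r; apply: cmeasurableM; first exact: cmeasurable_cst.
exact: mF.
Qed.

Let F2B i x : cnorm1 (F i x) <= B + B.
Proof. exact: (cnorm1_fourier A B). Qed.

Let MB : exists L, forall i x, cnorm1 (M i x) <= L.
Proof.
exists (cnorm1 (1 : C) + \sum_(r < 4) cnorm1 ('i ^+ r : C) * (B + B)) => i x.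
apply: le_trans (cnorm1D _ _) _; apply: lerD.
  by case: (i == j); rewrite ?cnorm10// cnorm1_ge0.
apply: le_trans (cnorm1_sum _ _ _ _) _; apply: ler_sum => r _.
apply: le_trans (cnorm1M _ _) _.
by apply: ler_wpM2l; [exact: cnorm1_ge0|exact: F2B].
Qed.

Let iQM x i : cintegrable (upray x) (fun y => \sum_l q i l y * M l y).
Proof.
have [L ML] := MB.
apply: cintegrable_sum => [|l]; first exact: measurable_upray.
apply: (cintegrableM_bounded _ _ _ L) => //; first exact: measurable_upray.
- have [rq cq] := iQ i l.
  by split; apply: (@integrableS _ _ _ mu setT) => //; exact: measurable_upray.
- have [rM cM] := mM l.
  by split; apply: (@measurable_funS _ _ _ _ setT).
Qed.

(** Summing the four real systems with weights [i^r] undoes the splitting, by [cpart_sum], and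
    returns the complex equation. *)
Let Bh_eq i x : Bh i x = - cint (upray x) (fun y => e i x y * \sum_l q i l y * M l y).
Proof.
have mup := measurable_upray x.
have isrc r : cintegrable (upray x) (fun y => (p (i, r) y)%:C * e i x y).
  exact: (cintegrable_fourier_source (a \o fst) p).
have iterm r l : cintegrable (upray x) (fun y => (w (i, r) l y)%:C * (e i x y * F l y)).
  exact: (cintegrable_fourier_term w (a \o fst) iw A B).
have isum r : cintegrable (upray x)
    (fun y => \sum_l (w (i, r) l y)%:C * (e i x y * F l y)).
  exact: cintegrable_sum.
transitivity (cint (upray x) (fun y => \sum_(r < 4) 'i ^+ r *
    ((p (i, r) y)%:C * e i x y + \sum_l (w (i, r) l y)%:C * (e i x y * F l y)))).
  rewrite cint_sum//; last first.
    by move=> r; apply: cintegrableZ => //; exact: cintegrableD.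
  apply: eq_bigr => r _; rewrite cintZ//; last exact: cintegrableD.
  rewrite cintD// cint_sum//; congr (_ * _).
  exact: (fourier_eq w (a \o fst) p iw ip A B).
rewrite -cintN//; last first.
  under eq_fun do rewrite mulrC.
  apply: (cintegrableM_bounded _ _ _ 2) => //.
  - by have [? ?] := me i x; split; apply: (@measurable_funS _ _ _ _ setT).
  - by move=> y _; exact: cnorm1_cexpi.
apply: eq_cint => y _.
transitivity ((\sum_(r < 4) 'i ^+ r * (p (i, r) y)%:C) * e i x y +
   \sum_l (\sum_(r < 4) 'i ^+ r * (w (i, r) l y)%:C) * (e i x y * F l y)).
  under eq_bigr do rewrite mulrDr.
  rewrite big_split /=; congr (_ + _).
    rewrite mulr_suml; by apply: eq_bigr => r _; rewrite -mulrA.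
  under eq_bigr do rewrite mulr_sumr.
  rewrite exchange_big /=; apply: eq_bigr => l _.
  rewrite mulr_suml; by apply: eq_bigr => r _; rewrite -mulrA.
rewrite /p /w /= cpart_sum; under eq_bigr do rewrite cpart_sum /=.
(* The Kronecker delta inside [M] produces the source [- Q_ij], and the remainder produces the
   coupling. *)
rewrite /M; under [in RHS]eq_bigr do rewrite mulrDr.
rewrite big_split /= mulrDr opprD; congr (_ + _).
  rewrite (bigD1 j)//= big1; last by move=> l /negPf ->; rewrite mulr0.
  by rewrite eqxx mulr1 addr0 mulNr mulrC.
transitivity (\sum_l \sum_(r < 4) (- 'i ^+ r * Q y i l * (e i x y * F (l, r) y))).
  by rewrite pair_bigA; apply: eq_bigr => -[l r] _.
rewrite [in RHS]mulr_sumr -sumrN.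
apply: eq_bigr => l _; rewrite !mulr_sumr -sumrN; apply: eq_bigr => r _.
by rewrite /q; ring.
Qed.

Lemma kernel_volterra : volterra_solution q e (fun i => (i == j)%:R) M.
Proof.
split => // i x; rewrite /M -Bh_eq; exact.
Qed.

Let expiS_mulE (t : R) (X : 'M[C]_n) i l :
  (expiS mp mm t *m X) i l = cexpi (t * sigma R i) * X i l.
Proof. by rewrite /expiS mul_diag_mx !mxE. Qed.

Let jost_entry (Y : R -> 'M[C]_n) x y i :
  (expiS mp mm (- (k * (y - x))) *m Q y *m Y y) i j =
  cexpi (- (k * (y - x)) * sigma R i) * \sum_l q i l y * Y y l j.
Proof. by rewrite -mulmxA expiS_mulE mxE. Qed.

Lemma jost_volterra Psi : is_Jost_Psi Q Psi ->
  volterra_solution q e (fun i => (i == j)%:R)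
    (fun i x => Psi x k i j * cexpi (- (k * x) * sigma R j)).
Proof.
move=> /(_ k)[cP jP].
have mup := @measurable_upray R.
have mP i : cmeasurable _ R setT (fun x => Psi x k i j).
  by have [rP iP] := cP i j; split; exact: continuous_measurable_fun.
have mc s : cmeasurable _ R setT (fun x => cexpi (- (k * x) * s)).
  apply: cmeasurable_cexpi; apply: measurable_funM => //; apply: measurable_funN.
  exact: measurable_funM.
have iF x i : cintegrable (upray x)
    (fun y => cexpi (- (k * (y - x)) * sigma R i) * \sum_l q i l y * Psi y k l j).
  have [+ _] := jP x; move=> /(_ i j) H.
  apply: (eq_cintegrable _ _ _ (mup x) _ H) => y _.
  exact: (jost_entry (fun y => Psi y k)).
(* With [s = sigma j], the relation [s^2 = 1] gives [s (1 - s sigma_i) = s - sigma_i], so the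
   normalised Jost phase is the phase [e] of the kernel system. *)
have eE x y i : cexpi (- (k * (y - x)) * sigma R i) * cexpi (- (k * x) * sigma R j) =
    e i x y * cexpi (- (k * y) * sigma R j).
  rewrite /e -!cexpiD; congr cexpi; rewrite /a /kj.
  rewrite [X in _ = X + _](_ : _ =
    (k * (y - x)) * (sigma R j - (sigma R j * sigma R j) * sigma R i)); last by ring.
  by rewrite sj; ring.
have sumE y i (z : C) : \sum_l q i l y * (Psi y k l j * z) = (\sum_l q i l y * Psi y k l j) * z.
  by rewrite mulr_suml; apply: eq_bigr => l _; rewrite mulrA.
split => [i|i x|i x].
- exact: cmeasurableM.
(* Integrability is known only with the Jost phase included; multiplication by the inverse phase and
   by the normalising one, both bounded, removes it. *)
- apply: (eq_cintegrable _ (fun y =>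
    (cexpi (- (k * (y - x)) * sigma R i) * \sum_l q i l y * Psi y k l j) *
    (cexpi (k * (y - x) * sigma R i) * cexpi (- (k * y) * sigma R j)))) => //.
    move=> y _; rewrite sumE mulrACA -cexpiD -mulrDl addNr mul0r cexpi0.
    by rewrite mul1r.
  apply: (cintegrableM_bounded _ _ _ (2 * 2)) => //.
  + have H : cmeasurable _ R setT
        (fun y => cexpi (k * (y - x) * sigma R i) * cexpi (- (k * y) * sigma R j)).
      apply: cmeasurableM => //; apply: cmeasurable_cexpi.
      by apply: measurable_funM => //; apply: measurable_funM => //; exact: measurable_funB.
    by have [? ?] := H; split; apply: (@measurable_funS _ _ _ _ setT).
  + move=> y _; apply: le_trans (cnorm1M _ _) _.
    by apply: ler_pM; rewrite ?cnorm1_ge0 ?cnorm1_cexpi.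
- have [_ ->] := jP x; rewrite !mxE mulrBl; congr (_ - _).
    case: eqVneq => [->|]; rewrite ?mulr0n ?mul0r//.
    by rewrite mulr1n mulNr mulrC cexpiNK.
  rewrite mulrC -cintZ; last 2 first.
  - exact: mup.
  - by have [+ _] := jP x; move=> /(_ i j).
  apply: (eq_cint (upray x)) => y _; rewrite (jost_entry (fun y => Psi y k)) sumE mulrA.
  rewrite [_ * cexpi (_ * sigma R i)]mulrC eE.
  by rewrite -!mulrA; congr (_ * _); rewrite mulrC.
Qed.

Lemma jost_column Psi i x : is_Jost_Psi Q Psi ->
  Psi x k i j * cexpi (- (k * x) * sigma R j) = (i == j)%:R + Bh i x.
Proof.
move=> jP.
apply: (volterra_unique q e (fun i => (i == j)%:R) _ _ _
  (fun i x => Psi x k i j * cexpi (- (k * x) * sigma R j)) M) => //.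
- by move=> *; exact: cnorm1_cexpi.
- exact: jost_volterra.
- exact: kernel_volterra.
Qed.

Let K (i : 'I_n) (x y : R) : C := \sum_(r < 4) 'i ^+ r * (A (i, r) x (y - x))%:C.

Let f (i : 'I_n) (x t : R) : C := \sum_(r < 4) 'i ^+ r * (A (i, r) x t)%:C.

Let f_supp i x t : t < 0 -> f i x t = 0.
Proof. by move=> t0; rewrite /f big1// => r _; rewrite Asupp// mulr0. Qed.

Let iAC i x : cintegrable setT (fun t => (A i x t)%:C).
Proof.
(* At frequency [0] the Fourier integrand is the density itself. *)
apply: eq_cintegrable (cintegrable_fourier A B mA A0 AB 0 i x) => // t _.
by rewrite mul0r cexpi0 mul1r.
Qed.

Let if_ i x : cintegrable setT (f i x).
Proof. by apply: cintegrable_sum => // r; exact: cintegrableZ. Qed.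

Lemma cintegrable_kernel i x : cintegrable (upray x) (K i x).
Proof. exact: (cintegrable_shift x (f i x)). Qed.

Lemma cnorm1_kernel i x :
  (\int[mu]_(y in upray x) (cnorm1 (K i x y))%:E <= (\sum_(r < 4) B)%:E)%E.
Proof.
have mf := measurable_int _ (integrable_cnorm1 _ _ measurableT (if_ i x)).
rewrite (integral_shift x (fun t => (cnorm1 (f i x t))%:E) mf); last first.
  by move=> t /f_supp ->; rewrite cnorm10.
have mAr r : measurable_fun setT (fun t => (A (i, r) x t)%:E).
  by have [h _] := iAC (i, r) x; exact: measurable_int h.
apply: (@le_trans _ _ (\int[mu]_t \sum_(r < 4) (A (i, r) x t)%:E)%E).
  apply: ge0_le_integral => //.
  - by move=> t _; rewrite lee_fin cnorm1_ge0.
  - by apply: emeasurable_sum => r; exact: mAr.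
  - move=> t _; rewrite sumEFin lee_fin; apply: le_trans (cnorm1_sum _ _ _ _) _.
    by apply: ler_sum => r _; rewrite cnorm1_iX /cnorm1 /= normr0 addr0 ger0_norm.
rewrite -sumEFin ge0_integral_sum//; last first.
  by move=> r t _; rewrite lee_fin.
exact: lee_sum.
Qed.

Lemma jost_kernel Psi i x : is_Jost_Psi Q Psi ->
  Psi x k i j * cexpi (- (k * x) * sigma R j) =
  (i == j)%:R + cint (upray x) (fun y => cexpi (sigma R j * k * (y - x)) * K i x y).
Proof.
move=> jP; rewrite jost_column//; congr (_ + _).
pose g t := \sum_(r < 4) 'i ^+ r * (cexpi (kj * t) * (A (i, r) x t)%:C).
have ig (r : 'I_4) : cintegrable setT (fun t => 'i ^+ r * (cexpi (kj * t) * (A (i, r) x t)%:C)).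
  by apply: cintegrableZ => //; exact: (cintegrable_fourier A B).
transitivity (cint setT g).
  rewrite cint_sum//; apply: eq_bigr => r _; rewrite cintZ//.
  exact: (cintegrable_fourier A B).
rewrite -(cint_shift x); last 2 first.
- exact: cintegrable_sum.
- by move=> t t0; rewrite /g big1// => r _; rewrite Asupp// !mulr0.
apply: eq_cint => y _; rewrite /g /K mulr_sumr; apply: eq_bigr => r _.
by rewrite mulrCA.
Qed.

End kernel.

(** The kernel system involves no frequency, so [A] is fixed before [k] and [Psi], and one kernel
    serves all of them. *)
Lemma column_kernel : exists (K : 'I_n -> R -> R -> C) (B : R),
  [/\ forall i x, cintegrable (upray x) (K i x),
      forall i x, (\int[mu]_(y in upray x) (cnorm1 (K i x y))%:E <= B%:E)%E &
      forall Psi, is_Jost_Psi Q Psi -> forall x k i,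
        Psi x k i j * cexpi (- (k * x) * sigma R j) =
        (i == j)%:R + cint (upray x) (fun y => cexpi (sigma R j * k * (y - x)) * K i x y)].
Proof.
have [A [B [mA A0 Asupp AB Aeq]]] := @nonneg_system R T w (fun i => a i.1) p
  (fun i l x => cpart_ge0 _ _) iw (fun i => a_ge0 i.1) (fun i x => cpart_ge0 _ _) ip p_eq0.
exists (fun (i : 'I_n) (x y : R) => \sum_(r < 4) 'i ^+ r * (A (i, r) x (y - x))%:C),
  (\sum_(r < 4) B); split.
- by move=> i x; exact: (cintegrable_kernel A B).
- by move=> i x; exact: (cnorm1_kernel A B).
- by move=> Psi jP x k i; exact: (jost_kernel A B).
Qed.

End column.

(** * Kernels of the Faddeev matrices *)

Section matrix_norm.
Context {R : realType}.
Notation mu := (@lebesgue_measure R).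
Notation C := R[i].

Lemma sum_sqr_le (I : finType) (b : I -> R) : (forall i, 0 <= b i) ->
  \sum_i b i ^+ 2 <= (\sum_i b i) ^+ 2.
Proof.
move=> b0; rewrite expr2 mulr_suml; apply: ler_sum => i _; rewrite expr2.
by apply: ler_wpM2l => //; rewrite (bigD1 i)//= lerDl sumr_ge0.
Qed.

Lemma cmxnorm_le (m n : nat) (X : 'M[C]_(m, n)) :
  cmxnorm X <= \sum_i \sum_j cnorm1 (X i j).
Proof.
set S := \sum_i _.
have S0 : 0 <= S by apply: sumr_ge0 => i _; apply: sumr_ge0 => j _; exact: cnorm1_ge0.
rewrite -(ger0_norm S0) -sqrtr_sqr /cmxnorm ler_wsqrtr// /S pair_big.
rewrite pair_big /=; apply: le_trans (sum_sqr_le _ _ _); last first.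
  by move=> ij; exact: cnorm1_ge0.
apply: ler_sum => -[i j] _ /=; rewrite /cnorm1.
rewrite -(real_normK (num_real (complex.Re _))) -(real_normK (num_real (complex.Im _))).
have := normr_ge0 (complex.Re (X i j)); have := normr_ge0 (complex.Im (X i j)).
set u := `|_|; set v := `|_| => v0 u0; rewrite sqrrD -addrA lerD2l lerDr.
by rewrite mulrn_wge0// mulr_ge0.
Qed.

Lemma measurable_cmxnorm (m n : nat) (D : set R) (X : R -> 'M[C]_(m, n)) :
  mxintegrable D X -> measurable_fun D (fun y => cmxnorm (X y)).
Proof.
move=> iX.
have msqrt : measurable_fun setT (@Num.sqrt R).
  by apply: continuous_measurable_fun; exact: sqrt_continuous.
apply: (measurableT_comp msqrt); apply: measurable_sum => i; apply: measurable_sum => j.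
have [r c] := cintegrable_measurable _ _ (iX i j).
by apply: measurable_funD; exact: measurable_funX.
Qed.

End matrix_norm.

(** * Integrals under [x |-> -x] *)

Section reflection.
Context {R : realType}.
Notation mu := (@lebesgue_measure R).
Notation C := R[i].

Let opp : R -> measurableTypeR R := -%R.

Let mopp : measurable_fun setT opp.
Proof. exact: oppr_measurable. Qed.

Lemma integral_opp (D : set R) (f : R -> \bar R) : measurable D -> measurable_fun D f ->
  (\int[mu]_(x in -%R @^-1` D) f (- x)%R = \int[mu]_(x in D) f x)%E.
Proof. exact: (integral_preserving opp mopp lebesgue_measureN). Qed.

Lemma cintegrable_opp (D : set R) (f : R -> C) : measurable D -> cintegrable D f ->
  cintegrable (-%R @^-1` D) (fun x => f (- x)).
Proof.
move=> mD [rf jf]; split.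
  exact: (integrable_preserving opp mopp lebesgue_measureN D _ mD rf).
exact: (integrable_preserving opp mopp lebesgue_measureN D _ mD jf).
Qed.

Lemma cint_opp (D : set R) (f : R -> C) : measurable D -> cintegrable D f ->
  cint (-%R @^-1` D) (fun x => f (- x)) = cint D f.
Proof.
move=> mD [rf jf]; apply: complex_eqP => /=; rewrite /Rintegral; congr fine.
  exact: (integral_opp D _ mD (measurable_int _ rf)).
exact: (integral_opp D _ mD (measurable_int _ jf)).
Qed.

Lemma opp_upray (x : R) : -%R @^-1` upray (- x) = downray x.
Proof. by apply/seteqP; split => y; rewrite /upray /downray /= lerN2. Qed.

Lemma opp_downray (x : R) : -%R @^-1` downray (- x) = upray x.
Proof. by apply/seteqP; split => y; rewrite /upray /downray /= lerN2. Qed.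

End reflection.

(** * Assembling the columns, and reduction of left kernels to right kernels *)

Section faddeev.
Context {R : realType} {mp mm : nat}.
Notation mu := (@lebesgue_measure R).
Notation C := R[i].
Notation n := (mp + 1 + mm)%N.

Lemma Faddeev_entry (Psi : R -> R -> 'M[C]_n) x k i j :
  Faddeev Psi x k i j = Psi x k i j * cexpi (- (k * x) * sigma R j).
Proof. by rewrite /Faddeev /expiS mul_mx_diag !mxE. Qed.

(** The columns of [E] are standard basis vectors; this treats [e_plus] and [e_minus] at once. *)
Definition selects {q : nat} (E : 'M[C]_(n, q)) (phi : 'I_q -> 'I_n) : Prop :=
  forall i j, E i j = (i == phi j)%:R.

Lemma selects_mul (q : nat) (E : 'M[C]_(n, q)) phi (X : 'M[C]_n) i j :
  selects E phi -> (X *m E) i j = X i (phi j).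
Proof.
move=> sE; rewrite mxE (bigD1 (phi j))//= big1 ?addr0.
  by rewrite sE eqxx mulr1.
by move=> l /negPf; rewrite sE => ->; rewrite mulr0.
Qed.

Definition right_kernel (q : nat) (E : 'M[C]_(n, q)) (s : R) (Q : R -> 'M[C]_n)
    (K : R -> R -> 'M[C]_n) (B : R) : Prop :=
  [/\ forall x, mxintegrable (upray x) (fun y => K x y *m E),
      forall x, (\int[mu]_(y in upray x) (cmxnorm (K x y *m E))%:E <= B%:E)%E &
      forall Psi, is_Jost_Psi Q Psi -> forall x k,
        Faddeev Psi x k *m E = E + mxint (upray x)
          (fun y => cexpi (s * k * (y - x)) *: (K x y *m E))].

Lemma exists_right_kernel (Q : R -> 'M[C]_n) : admissible_potential Q ->
  exists K : R -> R -> 'M[C]_n, forall (q : nat) (E : 'M[C]_(n, q)) phi (s : R),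
    selects E phi -> (forall j, sigma R (phi j) = s) -> s * s = 1 ->
    exists B, right_kernel q E s Q K B.
Proof.
move=> aQ.
(* Stated as an implication so that the choice runs over all columns; the middle one, where [sigma]
   is [0], receives the zero kernel. *)
pose P (j : 'I_n) (KB : ('I_n -> R -> R -> C) * R) := sigma R j * sigma R j = 1 ->
  [/\ forall i x, cintegrable (upray x) (KB.1 i x),
      forall i x, (\int[mu]_(y in upray x) (cnorm1 (KB.1 i x y))%:E <= KB.2%:E)%E &
      forall Psi, is_Jost_Psi Q Psi -> forall x k i,
        Psi x k i j * cexpi (- (k * x) * sigma R j) = (i == j)%:R +
        cint (upray x) (fun y => cexpi (sigma R j * k * (y - x)) * KB.1 i x y)].
have /choice[KB PKB] : forall j, exists KB, P j KB.
  move=> j; have [sj|sj] := pselect (sigma R j * sigma R j = 1).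
    by have [K [B H]] := column_kernel Q aQ j sj; exists (K, B).
  by exists (fun _ _ _ => 0, 0).
exists (fun x y => \matrix_(i, j) (KB j).1 i x y) => q E phi s sE sphi ss.
have Pphi j := PKB (phi j).
have mup := @measurable_upray R.
have KE x y i j : ((\matrix_(i, j) (KB j).1 i x y) *m E) i j = (KB (phi j)).1 i x y.
  by rewrite (selects_mul _ _ phi)// mxE.
have iK x : mxintegrable (upray x) (fun y => (\matrix_(i, j) (KB j).1 i x y) *m E).
  move=> i j; have [|h _ _] := Pphi j; first by rewrite sphi.
  by apply: (eq_cintegrable _ _ _ (mup x) _ (h i x)) => y _; rewrite KE.
exists (\sum_(i < n) \sum_j (KB (phi j)).2); split => //.
- move=> x.
  have mK i j : measurable_fun (upray x) (fun y => (cnorm1 ((KB (phi j)).1 i x y))%:E).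
    have [|h _ _] := Pphi j; first by rewrite sphi.
    exact/measurable_EFinP/measurable_cnorm1/cintegrable_measurable.
  apply: (@le_trans _ _ (\int[mu]_(y in upray x)
      \sum_i \sum_j (cnorm1 ((KB (phi j)).1 i x y))%:E)%E).
    apply: ge0_le_integral.
    - exact: mup.
    - by move=> y _; rewrite lee_fin /cmxnorm sqrtr_ge0.
    - by apply/measurable_EFinP; exact: (measurable_cmxnorm _ _ _ _ (iK x)).
    - by apply: emeasurable_sum => i; apply: emeasurable_sum => j; exact: mK.
    - move=> y _; apply: (@le_trans _ _ (\sum_i \sum_j cnorm1 ((KB (phi j)).1 i x y))%:E).
        rewrite lee_fin; apply: le_trans (cmxnorm_le _ _ _) _.
        by apply: ler_sum => i _; apply: ler_sum => j _; rewrite KE.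
      by rewrite -sumEFin; apply: lee_sum => i _; rewrite sumEFin.
  rewrite ge0_integral_sum//; last 3 first.
  - exact: mup.
  - by move=> i; apply: emeasurable_sum => j; exact: mK.
  - by move=> i y _; apply: sume_ge0 => j _; rewrite lee_fin cnorm1_ge0.
  rewrite -sumEFin; apply: lee_sum => i _.
  rewrite ge0_integral_sum//; last 3 first.
  - exact: mup.
  - by move=> j; exact: mK.
  - by move=> j y _; rewrite lee_fin cnorm1_ge0.
  rewrite -sumEFin; apply: lee_sum => j _.
  by have [|_ h _] := Pphi j; first by rewrite sphi.
- move=> Psi jP x k; apply/matrixP => i j.
  rewrite (selects_mul _ _ phi)// Faddeev_entry.
  have [|_ _ ->//] := Pphi j; first by rewrite sphi.
  rewrite [RHS]mxE sE [X in _ = _ + X]mxE; congr (_ + _).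
  by apply: eq_cint => y _; rewrite [in RHS]mxE KE sphi.
Qed.

(** The signs of [x] and [k] cancel in [e^{ikx Sigma}] and, after [y |-> -y], in the phase of the
    integrand. The opposite sign in front of the integral is absorbed into the potential. *)
Lemma jost_reflect (Q : R -> 'M[C]_n) Phi : is_Jost_Phi Q Phi ->
  is_Jost_Psi (fun x => - Q (- x)) (fun x k => Phi (- x) (- k)).
Proof.
move=> jP k; have [cP eP] := jP (- k); split.
  move=> i j; have [rP iP] := cP i j; split.
    move=> x; apply: (@continuous_comp _ _ _ -%R (fun x => complex.Re (Phi x (- k) i j))).
      exact: opp_continuous.
    exact: rP.
  move=> x; apply: (@continuous_comp _ _ _ -%R (fun x => complex.Im (Phi x (- k) i j))).
    exact: opp_continuous.
  exact: iP.
move=> x F.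
pose G y := expiS mp mm (- k * (- x - y)) *m Q y *m Phi y (- k).
have [iF ->] := eP (- x); rewrite -/(G) in iF *.
have FG y : F y = - G (- y).
  rewrite /F /G mulmxN mulNmx; congr (- (expiS _ _ _ *m _ *m _)).
  by ring.
have mdn := @measurable_downray R (- x).
have iG i j : cintegrable (upray x) (fun y => G (- y) i j).
  by rewrite -opp_downray; apply: (cintegrable_opp _ (fun y => G y i j)) => //; exact: iF.
have FE i j y : F y i j = - G (- y) i j by rewrite FG mxE.
split.
  move=> i j; apply: (eq_cintegrable _ (fun y => - G (- y) i j)).
  - exact: measurable_upray.
  - by move=> y _; rewrite FE.
  - by apply: cintegrableN; [exact: measurable_upray|exact: iG].
apply/matrixP => i j; rewrite [LHS]mxE [RHS]mxE mulrNN; congr (_ + _).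
rewrite [RHS]mxE [LHS]mxE [in RHS]mxE.
rewrite (eq_cint (upray x) _ (fun y => - G (- y) i j)); last by move=> y _; rewrite FE.
rewrite cintN; [|exact: measurable_upray|exact: iG]; rewrite opprK.
by rewrite -[in RHS]opp_downray (cint_opp _ (fun y => G y i j)).
Qed.

Lemma admissible_reflect (Q : R -> 'M[C]_n) :
  admissible_potential Q -> admissible_potential (fun x => - Q (- x)).
Proof.
move=> [Q0 iQ]; split; first by move=> x i j b; rewrite mxE Q0// oppr0.
move=> i j; apply: (eq_cintegrable _ (fun y => - Q (- y) i j)) => //.
  by move=> y _; rewrite mxE.
apply: cintegrableN => //.
by have := cintegrable_opp setT (fun y => Q y i j) measurableT (iQ i j).
Qed.

(** The Faddeev matrix of the reflected solution at [(-x, -k)] is that of [Phi] at [(x, k)], since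
    the normalising phase depends on the product [k x] only. *)
Lemma left_kernel (q : nat) (E : 'M[C]_(n, q)) (s : R) (Q : R -> 'M[C]_n)
    (K : R -> R -> 'M[C]_n) (B : R) :
  right_kernel q E s (fun x => - Q (- x)) K B ->
  [/\ forall x, mxintegrable (downray x) (fun y => K (- x) (- y) *m E),
      forall x, (\int[mu]_(y in downray x) (cmxnorm (K (- x) (- y) *m E))%:E <= B%:E)%E &
      forall Phi, is_Jost_Phi Q Phi -> forall x k,
        Faddeev Phi x k *m E = E + mxint (downray x)
          (fun y => cexpi (- (s * k * (x - y))) *: (K (- x) (- y) *m E))].
Proof.
move=> [iK KB rK]; have mup := @measurable_upray R.
split.
- move=> x i j; rewrite -opp_upray.
  by apply: (cintegrable_opp _ (fun y => (K (- x) y *m E) i j)) => //; exact: iK.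
- move=> x; apply: le_trans (KB (- x)); rewrite -opp_upray.
  rewrite (integral_opp (upray (- x)) (fun y => (cmxnorm (K (- x) y *m E))%:E))//.
  by apply/measurable_EFinP; exact: (measurable_cmxnorm _ _ _ _ (iK (- x))).
- move=> Phi jP x k.
  have FE : Faddeev (fun x k => Phi (- x) (- k)) (- x) (- k) = Faddeev Phi x k.
    by rewrite /Faddeev !opprK mulrNN.
  rewrite -FE (rK _ (jost_reflect _ _ jP)); apply: f_equal.
  apply/matrixP => i j; rewrite [LHS]mxE [RHS]mxE -[in RHS]opp_upray.
  have ic : cintegrable (upray (- x))
      (fun y => (cexpi (s * - k * (y - - x)) *: (K (- x) y *m E)) i j).
    apply: (eq_cintegrable _ (fun y => (K (- x) y *m E) i j * cexpi (s * - k * (y - - x)))) => //.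
      by move=> y _; rewrite [RHS]mxE mulrC.
    apply: (cintegrableM_bounded _ _ _ 2) => //; first exact: iK.
      by apply: cmeasurable_cexpi; apply: measurable_funM => //; exact: measurable_funD.
    by move=> y _; exact: cnorm1_cexpi.
  etransitivity; first exact: (esym (cint_opp _ _ (mup (- x)) ic)).
  apply: eq_cint => y _; rewrite [LHS]mxE [RHS]mxE; congr (cexpi _ * _).
  by ring.
Qed.

End faddeev.

(** * The outer blocks as column selections *)

Section blocks.
Context {R : realType} {mp mm : nat}.
Notation n := (mp + 1 + mm)%N.

Lemma e_plus_selects : @selects R mp mm mp (e_plus R mp mm) (fun j => lshift mm (lshift 1 j)).
Proof.
move=> i j; rewrite /e_plus -(splitK i); case: (fintype.split i) => i' /=.
  rewrite col_mxEu (inj_eq (@lshift_inj _ _)) -(splitK i').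
  case: (fintype.split i') => i'' /=.
    by rewrite col_mxEu mxE (inj_eq (@lshift_inj _ _)).
  by rewrite col_mxEd mxE eq_rlshift.
by rewrite col_mxEd mxE eq_rlshift.
Qed.

Lemma e_minus_selects : @selects R mp mm mm (e_minus R mp mm) (fun j => rshift (mp + 1) j).
Proof.
move=> i j; rewrite /e_minus -(splitK i); case: (fintype.split i) => i' /=.
  by rewrite col_mxEu mxE eq_lrshift.
by rewrite col_mxEd mxE (inj_eq (@rshift_inj _ _)).
Qed.

Lemma sigma_plus j : sigma R (lshift mm (lshift 1 j) : 'I_n) = 1.
Proof. by rewrite /sigma /= ltn_ord. Qed.

Lemma sigma_minus j : sigma R (rshift (mp + 1) j : 'I_n) = -1.
Proof.
rewrite /sigma /= ltnNge -addnA leq_addr /=.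
by rewrite -[X in _ == X]addn0 eqn_add2l add1n.
Qed.

End blocks.

Theorem theorem2p1 (R : realType) (mp mm : nat) (Q : R -> 'M[R[i]]_(mp + 1 + mm)) :
  (1 <= mp)%N -> (1 <= mm)%N ->
  admissible_potential Q ->
  exists K J : R -> R -> 'M[R[i]]_(mp + 1 + mm),
    (* integrability and uniform bounds *)
    (forall x : R,
        mxintegrable [set y : R | (x <= y)%R] (fun y => K x y *m e_plus R mp mm) /\
        mxintegrable [set y : R | (x <= y)%R] (fun y => K x y *m e_minus R mp mm) /\
        mxintegrable [set y : R | (y <= x)%R] (fun y => J x y *m e_plus R mp mm) /\
        mxintegrable [set y : R | (y <= x)%R] (fun y => J x y *m e_minus R mp mm)) /\
    (exists B : R, forall x : R,
        (\int[lebesgue_measure]_(y in [set y : R | (x <= y)%R])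
            (cmxnorm (K x y *m e_plus R mp mm))%:E
         + \int[lebesgue_measure]_(y in [set y : R | (y <= x)%R])
            (cmxnorm (J x y *m e_plus R mp mm))%:E <= B%:E)%E /\
        (\int[lebesgue_measure]_(y in [set y : R | (x <= y)%R])
            (cmxnorm (K x y *m e_minus R mp mm))%:E
         + \int[lebesgue_measure]_(y in [set y : R | (y <= x)%R])
            (cmxnorm (J x y *m e_minus R mp mm))%:E <= B%:E)%E) /\
    (* representations of the Faddeev matrices *)
    (forall Psi Phi : R -> R -> 'M[R[i]]_(mp + 1 + mm),
      is_Jost_Psi Q Psi -> is_Jost_Phi Q Phi ->
      forall x k : R,
        Faddeev Psi x k *m e_plus R mp mm = e_plus R mp mm +
          mxint [set y : R | (x <= y)%R]
            (fun y => cexpi (k * (y - x)) *: (K x y *m e_plus R mp mm)) /\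
        Faddeev Psi x k *m e_minus R mp mm = e_minus R mp mm +
          mxint [set y : R | (x <= y)%R]
            (fun y => cexpi (- (k * (y - x))) *: (K x y *m e_minus R mp mm)) /\
        Faddeev Phi x k *m e_plus R mp mm = e_plus R mp mm +
          mxint [set y : R | (y <= x)%R]
            (fun y => cexpi (- (k * (x - y))) *: (J x y *m e_plus R mp mm)) /\
        Faddeev Phi x k *m e_minus R mp mm = e_minus R mp mm +
          mxint [set y : R | (y <= x)%R]
            (fun y => cexpi (k * (x - y)) *: (J x y *m e_minus R mp mm))).
Proof.
move=> _ _ aQ.
have [K HK] := exists_right_kernel Q aQ.
have [J HJ] := exists_right_kernel _ (admissible_reflect Q aQ).
have sN : -1 * -1 = 1 :> R by rewrite mulrNN mulr1.
have [Bp [iKp bKp rKp]] := HK _ _ _ 1 e_plus_selects sigma_plus (mulr1 1).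
have [Bm [iKm bKm rKm]] := HK _ _ _ (-1) e_minus_selects sigma_minus sN.
have [Cp /left_kernel[iJp bJp rJp]] := HJ _ _ _ 1 e_plus_selects sigma_plus (mulr1 1).
have [Cm /left_kernel[iJm bJm rJm]] := HJ _ _ _ (-1) e_minus_selects sigma_minus sN.
exists K, (fun x y => J (- x) (- y)); split.
  by move=> x; split; [exact: iKp|split; [exact: iKm|split; [exact: iJp|exact: iJm]]].
split.
  (* Each of the four bounds is already uniform in [x]; the maximum serves both blocks. *)
  exists (Num.max (Bp + Cp) (Bm + Cm)) => x; split.
    apply: (le_trans (leeD (bKp x) (bJp x))).
    by rewrite -EFinD lee_fin le_max lexx.
  apply: (le_trans (leeD (bKm x) (bJm x))).
  by rewrite -EFinD lee_fin le_max lexx orbT.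
move=> Psi Phi jPsi jPhi x k.
have eqmx (q : nat) (D : set R) (F : R -> 'M[R[i]]_(mp + 1 + mm, q)) (f g : R -> R) :
    (forall y, f y = g y) -> mxint D (fun y => cexpi (f y) *: F y) =
    mxint D (fun y => cexpi (g y) *: F y).
  by move=> fg; congr (mxint D _); apply/funext => y; rewrite fg.
split; first by rewrite (rKp _ jPsi); apply: f_equal; apply: eqmx => // y; rewrite mul1r.
split; first by rewrite (rKm _ jPsi); apply: f_equal; apply: eqmx => // y; rewrite mulN1r mulNr.
split; first by rewrite (rJp _ jPhi); apply: f_equal; apply: eqmx => // y; rewrite mul1r.
by rewrite (rJm _ jPhi); apply: f_equal; apply: eqmx => // y; rewrite mulN1r mulNr opprK.
Qed.
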